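(* Let $\mathcal K$ be a tame $d$-dimensional Kuranishi atlas with a reduction $\mathcal V$, and suppose that $\nu=(\nu_I:V_I\to E_I)_{I\in\mathcal I_{\mathcal K}}$ is a precompact transverse perturbation of $\mathfrak s_{\mathcal K}|_{\mathcal V}$. Then $|\mathbf Z^\nu|=|(\mathfrak s_{\mathcal K}|_{\mathcal V}+\nu)^{-1}(0)|$ is a smooth closed $d$-dimensional manifold. Moreover, its quotient topology agrees with the subspace topology on $\|(\mathfrak s_{\mathcal K}|_{\mathcal V}+\nu)^{-1}(0)\|\subset|\mathcal K|$.
   Context: $X$ is a compact metrizable space. A Kuranishi chart (trivial isotropy) for $X$ with footprint a nonempty open $F\subset X$ is $\mathbf K=(U,E,s,\psi)$ with $U$ a finite-dimensional smooth manifold (without boundary), $E$ a finite-dimensional real vector space, $s:U\to E$ smooth, $\psi:s^{-1}(0)\to X$ a homeomorphism onto $F$; $\dim\mathbf K=\dim U-\dim E$. A coordinate change $\widehat\Phi_{IJ}:\mathbf K_I\to\mathbf K_J$ ($F_I\cap F_J\neq\emptyset$) consists of an open $U_{IJ}\subset U_I$ with $U_{IJ}\cap s_I^{-1}(0)=\psi_I^{-1}(F_I\cap F_J)$, a smooth embedding $\phi_{IJ}:U_{IJ}\to U_J$ and a linear injection $\widehat\phi_{IJ}:E_I\to E_J$ with $s_J\circ\phi_{IJ}=\widehat\phi_{IJ}\circ s_I$, $\phi_{IJ}=\psi_J^{-1}\circ\psi_I$ on $U_{IJ}\cap s_I^{-1}(0)$, and the index condition: for all $u\in U_{IJ}$,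 $d_u\phi_{IJ}(\ker d_us_I)=\ker d_{\phi_{IJ}(u)}s_J$, and $E_I=\operatorname{im}d_us_I\oplus C$ implies $E_J=\operatorname{im}d_{\phi_{IJ}(u)}s_J\oplus\widehat\phi_{IJ}(C)$. A Kuranishi atlas $\mathcal K$ of dimension $d$ on $X$ consists of basic charts $\mathbf K_1,\dots,\mathbf K_N$ with footprints covering $X$; with $\mathcal I_{\mathcal K}=\{\emptyset\neq I\subset\{1,\dots,N\}:F_I:=\bigcap_{i\in I}F_i\neq\emptyset\}$, charts $\mathbf K_I$ with footprint $F_I$ for $I\in\mathcal I_{\mathcal K}$ ($\mathbf K_{\{i\}}=\mathbf K_i$), all of dimension $d$; and coordinate changes $\widehat\Phi_{IJ}$ for $I\subsetneq J$, such that for $I\subsetneq J\subsetneq L$: $\widehat\phi_{JL}\widehat\phi_{IJ}=\widehat\phi_{IL}$, $\phi_{IJ}^{-1}(U_{JL})\subset U_{IL}$, and $\phi_{JL}\phi_{IJ}=\phi_{IL}$ on $\phi_{IJ}^{-1}(U_{JL})$. Conventions: $U_{II}=U_I$, $\phi_{II}=\mathrm{id}$, $s_J^{-1}(E_I)=s_J^{-1}(\widehat\phi_{IJ}(E_I))$. It is tame if it is additive (each map $\prod_{i\in I}E_i\to E_I$, $(e_i)\mapsto\sum\widehat\phi_{iI}(e_i)$ is an isomorphism) and, for all indices (equalities allowed), $U_{IJ}\cap U_{IL}=U_{I(J\cup L)}$ for $I\subset J,L$ (with $U_{IH}=\emptyset$ for $H\notin\mathcal I_{\mathcal K}$) and $\phi_{IJ}(U_{IL})=U_{JL}\cap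 s_J^{-1}(E_I)$ for $I\subset J\subset L$. $|\mathcal K|=\bigsqcup_IU_I/\!\sim$, with $\sim$ generated by $(I,x)\sim(J,\phi_{IJ}(x))$ and quotient topology, has projection $\pi_{\mathcal K}$; $\iota_{\mathcal K}:X\to|\mathcal K|$, $p\mapsto[I,\psi_I^{-1}(p)]$ for any $I$ with $p\in F_I$. $A\sqsubset B$ means precompact inclusion. A reduction is $\mathcal V=\bigsqcup V_I$ with open $V_I\sqsubset U_I$, $V_I\cap s_I^{-1}(0)\neq\emptyset$ if $V_I\neq\emptyset$; $\pi_{\mathcal K}(\overline{V_I})\cap\pi_{\mathcal K}(\overline{V_J})\neq\emptyset$ only if $I\subset J$ or $J\subset I$; $\iota_{\mathcal K}(X)\subset\pi_{\mathcal K}(\mathcal V)$. A nested reduction $\mathcal C\sqsubset\mathcal V$ is a pair of reductions with precompact inclusion. A perturbation (reduced section) is a family of smooth $\nu_I:V_I\to E_I$ with $\nu_J\circ\phi_{IJ}=\widehat\phi_{IJ}\circ\nu_I$ on $V_I\cap\phi_{IJ}^{-1}(V_J)$ for $I\subsetneq J$. It is transverse if $s_I|_{V_I}+\nu_I\pitchfork0$ for all $I$; precompact if, with $(\mathfrak s_{\mathcal K}|_{\mathcal V}+\nu)^{-1}(0):=\bigsqcup_IZ_I$, $Z_I=(s_I|_{V_I}+\nu_I)^{-1}(0)$, one has $\pi_{\mathcal K}(\bigsqcup_IZ_I)\subset\pi_{\mathcal K}(\mathcal C)$ for some nested reduction $\mathcal C\sqsubset\mathcal V$. $|\mathbf Z^\nu|$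 is the quotient of $\bigsqcup_IZ_I$ by the equivalence relation generated by $(I,x)\sim(J,\phi_{IJ}(x))$ for $x\in Z_I\cap U_{IJ}$, $\phi_{IJ}(x)\in Z_J$, with the quotient topology, and smooth structure for which the maps $Z_I\to|\mathbf Z^\nu|$ are diffeomorphisms onto open subsets. $\|(\mathfrak s_{\mathcal K}|_{\mathcal V}+\nu)^{-1}(0)\|$ denotes the set $\pi_{\mathcal K}(\bigsqcup_IZ_I)$ with the subspace topology from $|\mathcal K|$; the inclusion $\bigsqcup Z_I\subset\bigsqcup U_I$ induces a continuous bijection $|\mathbf Z^\nu|\to\|(\mathfrak s_{\mathcal K}|_{\mathcal V}+\nu)^{-1}(0)\|$. A closed manifold is a compact manifold without boundary. *)

(* Defs.v *)
From HB Require Import structures.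
From Stdlib Require Import Relation_Operators.
From mathcomp Require Import all_boot all_order all_algebra.
From mathcomp Require Import generic_quotient all_classical all_reals all_analysis.
Set Implicit Arguments.
Unset Strict Implicit.
Unset Printing Implicit Defensive.
Import Order.TTheory GRing.Theory Num.Theory passmx.
Import numFieldNormedType.Exports.
Local Open Scope classical_set_scope.
Local Open Scope ring_scope.
Local Open Scope quotient_scope.

(* [f], defined on all of [S], restricts to a homeomorphism from [A] onto [B].
   The inverse is quantified universally because it only exists as a total
   function when [S] is inhabited; all choices of [g] agree on [B]. *)
Definition homeo_onto (S T : topologicalType) (A : set S) (f : S -> T)
    (B : set T) : Prop :=
  [/\ set_bij A B f, {within A, continuous f} &
      forall g : T -> S, {in A, cancel f g} -> {within B, continuous g}].

Definition metrizable (R : realType) (X : topologicalType) : Prop :=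
  exists (M : metricType R) (f : X -> M), homeo_onto setT f setT.

(* [closure A `&` B] is the closure of [A] in the subspace [B]. *)
Definition precompact_in (T : topologicalType) (A B : set T) : Prop :=
  A `<=` B /\ compact (closure A `&` B).

Definition gen_rel (T : Type) (r : T -> T -> Prop) : rel T :=
  fun x y => `[< clos_refl_sym_trans T r x y >].

Lemma gen_rel_class (T : Type) (r : T -> T -> Prop) : equiv_class_of (gen_rel r).
Proof.
split.
- by move=> x; apply/asboolP; exact: rst_refl.
- by move=> x y; apply/asboolP/asboolP => h; exact: rst_sym.
- by move=> y x z /asboolP h1 /asboolP h2; apply/asboolP; exact: rst_trans h1 h2.
Qed.

Canonical gen_equiv (T : Type) (r : T -> T -> Prop) :=
  EquivRelPack (gen_rel_class r).

Definition quotient_space (T : topologicalType) (r : T -> T -> Prop) :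
    topologicalType :=
  quotient_topology {eq_quot gen_equiv r}.

Definition qproj (T : topologicalType) (r : T -> T -> Prop) :
    T -> quotient_space r :=
  \pi_({eq_quot gen_equiv r})%qT.

Section Smooth.
Context {R : realType}.

(* [A] is meant to be open. *)
Fixpoint Ck (V W : normedModType R) (k : nat) (A : set V) (f : V -> W) : Prop :=
  match k with
  | 0 => forall x, A x -> {for x, continuous f}
  | k'.+1 => (forall x, A x -> differentiable f x) /\
             forall v, Ck k' A (fun x => 'd f x v)
  end.

Definition smooth_on (V W : normedModType R) (A : set V) (f : V -> W) : Prop :=
  forall k, Ck k A f.

Record chart (M : topologicalType) (n : nat) := Chart {
  cdom : set M;
  cmap :> M -> 'rV[R]_n;
  cinv : 'rV[R]_n -> M;
  cdom_open : open cdom;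
  cimg_open : open (cmap @` cdom);
  cmap_continuous : {within cdom, continuous cmap};
  cinv_continuous : {within cmap @` cdom, continuous cinv};
  cmapK : {in cdom, cancel cmap cinv}
}.

(* A smooth atlas, not necessarily maximal. The dimension is an integer and a
   manifold of negative dimension is empty. *)
Record smooth_structure (M : topologicalType) (d : int) := SmoothStructure {
  charts : set (chart M `|d|%N);
  charts_cover : forall x : M, exists2 c, charts c & cdom c x;
  charts_compat : forall c c', charts c -> charts c' ->
    smooth_on (c @` (cdom c `&` cdom c')) (c' \o cinv c);
  charts_dim : M -> 0 <= d
}.

Definition smooth_map (M N : topologicalType) (m n : int)
    (S : smooth_structure M m) (T : smooth_structure N n)
    (D : set M) (f : M -> N) : Prop :=
  {within D, continuous f} /\
  forall c c', charts S c -> charts T c' ->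
    smooth_on (c @` (D `&` cdom c `&` f @^-1` cdom c')) (c' \o f \o cinv c).

(* The differential of [f] at [u], tangent spaces being read in a chart [c] at
   [u] and a chart [c'] at [f u]; conditions on it are imposed for all such
   charts. *)
Definition dmap (M N : topologicalType) (m n : nat)
    (c : chart M m) (c' : chart N n) (f : M -> N) (u : M) :
    'Hom('rV[R]_m, 'rV[R]_n) :=
  linfun ('d (c' \o f \o cinv c) (c u) : 'rV[R]_m -> 'rV[R]_n).

Definition smooth_embedding (M N : topologicalType) (m n : int)
    (S : smooth_structure M m) (T : smooth_structure N n)
    (D : set M) (f : M -> N) : Prop :=
  [/\ smooth_map S T D f,
      (forall u c c', D u -> charts S c -> charts T c' ->
         cdom c u -> cdom c' (f u) -> lker (dmap c c' f u) = 0%VS) &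
      homeo_onto D f (f @` D)].

Definition diffeo_onto_open (M N : topologicalType) (m n : int)
    (S : smooth_structure M m) (T : smooth_structure N n) (f : M -> N) : Prop :=
  [/\ injective f, open (range f), smooth_map S T setT f &
      forall g : N -> M, cancel f g -> smooth_map T S (range f) g].

(* Maps to a finite-dimensional vector space [E] are differentiated in the
   coordinates of a basis of [E]. *)
Definition vcoord (E : vectType R) : E -> 'rV[R]_(\dim {:E}) :=
  rVof (vbasis {:E}).

Definition smooth_vmap (M : topologicalType) (m : int) (S : smooth_structure M m)
    (E : vectType R) (D : set M) (s : M -> E) : Prop :=
  forall c, charts S c ->
    smooth_on (c @` (D `&` cdom c)) (@vcoord E \o s \o cinv c).

Definition dvmap (M : topologicalType) (m : nat) (c : chart M m)
    (E : vectType R) (s : M -> E) (u : M) : 'Hom('rV[R]_m, E) :=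
  linfun (fun v => vecof (vbasis {:E})
                     ('d (@vcoord E \o s \o cinv c) (c u) v)).

Definition is_direct_sum (E : vectType R) (A B : {vspace E}) : Prop :=
  (A + B)%VS = fullv /\ (A :&: B)%VS = 0%VS.

Record kchart (X : topologicalType) := KChart {
  kU : topologicalType;
  kdim : nat;
  kS : smooth_structure kU kdim%:Z;
  kU_hausdorff : hausdorff_space kU;
  kU_countable : @second_countable kU;
  kE : vectType R;
  ks : kU -> kE;
  ks_smooth : smooth_vmap kS setT ks;
  kfoot : set X;
  kfoot_open : open kfoot;
  kfoot_nonempty : kfoot !=set0;
  (* only the restriction to the zero set of [ks] is meaningful *)
  kpsi : kU -> X;
  kpsi_homeo : homeo_onto [set x | ks x = 0] kpsi kfoot
}.

(* [cophi] is only meaningful on [codom]. *)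
Record coord_data (X : topologicalType) (KI KJ : kchart X) := CoordData {
  codom : set (kU KI);
  cophi : kU KI -> kU KJ;
  cohat : 'Hom(kE KI, kE KJ)
}.

Definition index_condition (X : topologicalType) (KI KJ : kchart X)
    (Phi : coord_data KI KJ) : Prop :=
  forall u c c', codom Phi u -> charts (kS KI) c -> charts (kS KJ) c' ->
    cdom c u -> cdom c' (cophi Phi u) ->
    let dsI := dvmap c (@ks _ KI) u in
    let dsJ := dvmap c' (@ks _ KJ) (cophi Phi u) in
    (dmap c c' (cophi Phi) u @: lker dsI)%VS = lker dsJ /\
    forall C : {vspace kE KI}, is_direct_sum (limg dsI) C ->
      is_direct_sum (limg dsJ) (cohat Phi @: C)%VS.

Record is_coord_change (X : topologicalType) (KI KJ : kchart X)
    (Phi : coord_data KI KJ) : Prop := IsCoordChange {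
  co_meet : kfoot KI `&` kfoot KJ !=set0;
  co_open : open (codom Phi);
  co_zero : codom Phi `&` [set x | ks x = 0] =
            [set x | ks x = 0 /\ (kfoot KI `&` kfoot KJ) (kpsi x)];
  co_emb : smooth_embedding (kS KI) (kS KJ) (codom Phi) (cophi Phi);
  co_inj : injective (cohat Phi);
  co_section : forall x, codom Phi x -> ks (cophi Phi x) = cohat Phi (ks x);
  co_psi : forall x, codom Phi x -> ks x = 0 -> kpsi (cophi Phi x) = kpsi x;
  co_index : index_condition Phi
}.

End Smooth.
Arguments chart : clear implicits.
Arguments smooth_structure : clear implicits.
Arguments kchart : clear implicits.

Definition kidx_pred (X : Type) (N : nat) (F : 'I_N -> set X) : pred {set 'I_N} :=
  fun I => (I != finset.set0) &&
           `[< \bigcap_(i in [set` I]) F i !=set0 >].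

Notation kidx F := {I : {set 'I_ _} | kidx_pred F I}.

Lemma kidx_single_subproof (X : Type) (N : nat) (F : 'I_N -> set X) (i : 'I_N) :
  F i !=set0 -> kidx_pred F (finset.set1 i).
Proof.
move=> [x Fx]; apply/andP; split; first by apply/set0Pn; exists i; rewrite inE.
by apply/asboolP; exists x => j /=; rewrite inE => /eqP ->.
Qed.

(* [kcoord I J] is meaningful for [I] contained in [J] only; the fields
   [kcodom_id], [kcophi_id] and [kcohat_id] are the conventions for [I = J]. *)
Record kuranishi_atlas (R : realType) (X : topologicalType) (d : int) :=
    KuranishiAtlas {
  kN : nat;
  kF : 'I_kN -> set X;
  kF_nonempty : forall i, kF i !=set0;
  kF_cover : \bigcup_(i in [set: 'I_kN]) kF i = [set: X];
  katlas_chart : kidx kF -> kchart R X;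
  katlas_foot : forall I : kidx kF,
    kfoot (katlas_chart I) = \bigcap_(i in [set` val I]) kF i;
  katlas_dim : forall I : kidx kF,
    (kdim (katlas_chart I))%:Z - (\dim {:kE (katlas_chart I)})%:Z = d;
  kcoord : forall I J : kidx kF, coord_data (katlas_chart I) (katlas_chart J);
  kcodom_id : forall I : kidx kF, codom (kcoord I I) = setT;
  kcophi_id : forall (I : kidx kF) x, cophi (kcoord I I) x = x;
  kcohat_id : forall (I : kidx kF) e, cohat (kcoord I I) e = e;
  coordP : forall I J : kidx kF, val I \proper val J -> is_coord_change (kcoord I J);
  cocycle_hat : forall I J L : kidx kF, val I \proper val J -> val J \proper val L ->
    forall e, cohat (kcoord J L) (cohat (kcoord I J) e) = cohat (kcoord I L) e;
  cocycle_dom : forall I J L : kidx kF, val I \proper val J -> val J \proper val L ->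
    codom (kcoord I J) `&` cophi (kcoord I J) @^-1` codom (kcoord J L)
      `<=` codom (kcoord I L);
  cocycle_phi : forall I J L : kidx kF, val I \proper val J -> val J \proper val L ->
    forall x, codom (kcoord I J) x ->
      codom (kcoord J L) (cophi (kcoord I J) x) ->
      cophi (kcoord J L) (cophi (kcoord I J) x) = cophi (kcoord I L) x
}.

Arguments kF {R X d} K _ : rename.
Arguments kF_nonempty {R X d} K _ : rename.
Arguments katlas_chart {R X d} K _ : rename.
Arguments kcoord {R X d} K _ _ : rename.

Section Atlas.
Context {R : realType} {X : topologicalType} {d : int}.
Variable K : kuranishi_atlas R X d.

Local Notation idx := (kidx (kF K)).
Local Notation U I := (kU (katlas_chart K I)).
Local Notation E I := (kE (katlas_chart K I)).
Local Notation UU I J := (codom (kcoord K I J)).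
Local Notation phi I J := (cophi (kcoord K I J)).
Local Notation hat I J := (cohat (kcoord K I J)).

Definition kidx_single (i : 'I_(kN K)) : idx :=
  exist (kidx_pred (kF K)) _ (kidx_single_subproof (kF_nonempty K i)).

Definition additive_atlas : Prop :=
  forall I : idx, bijective
    (fun e : {ffun forall i : {i : 'I_(kN K) | i \in val I},
                E (kidx_single (val i))} =>
       \sum_i hat (kidx_single (val i)) I (e i)).

(* [U_{IH}] for an arbitrary set [H], empty unless [H] is an index. *)
Definition kdom (I : idx) (H : {set 'I_(kN K)}) : set (U I) :=
  [set x | exists2 J : idx, val J = H & UU I J x].

Arguments kdom I H : clear implicits.

Definition tame : Prop :=
  [/\ additive_atlas,
      (forall I J L : idx, val I \subset val J -> val I \subset val L ->
         UU I J `&` UU I L = kdom I (val J :|: val L)%SET) &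
      (forall I J L : idx, val I \subset val J -> val J \subset val L ->
         phi I J @` UU I L =
         UU J L `&` [set y | exists e : E I, ks y = hat I J e])].

Definition ksum : topologicalType := {I : idx & U I}.

Variant kstep : ksum -> ksum -> Prop :=
  KStep (I J : idx) (x : U I) of val I \proper val J & UU I J x :
    kstep (existT _ I x) (existT _ J (phi I J x)).

Definition realization : topologicalType := quotient_space kstep.
Definition kproj : ksum -> realization := @qproj _ kstep.

Lemma iota_subproof (p : X) :
  exists w : ksum, ks (projT2 w) = 0 /\ kpsi (projT2 w) = p.
Proof.
have [i _ Fip] : (\bigcup_(i in [set: 'I_(kN K)]) kF K i) p by rewrite kF_cover.
have : kfoot (katlas_chart K (kidx_single i)) p.
  by rewrite katlas_foot => j /=; rewrite inE => /eqP ->.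
have [[_ _ sur] _ _] := kpsi_homeo (katlas_chart K (kidx_single i)).
by move=> /sur[x /= sx0 <-]; exists (existT _ (kidx_single i) x).
Qed.

(* The value does not depend on the chosen preimage of [p]. *)
Definition iotaK (p : X) : realization := kproj (projT1 (cid (iota_subproof p))).

(* The disjoint union of the [V I], as a subset of that of the [U I]. *)
Definition family_set (V : forall I : idx, set (U I)) : set ksum :=
  [set w | V (projT1 w) (projT2 w)].

Record is_reduction (V : forall I : idx, set (U I)) : Prop := IsReduction {
  red_open : forall I, open (V I);
  red_precompact : forall I, precompact_in (V I) setT;
  red_zero : forall I, V I !=set0 -> V I `&` [set x | ks x = 0] !=set0;
  red_meet : forall I J,
    [set kproj (existT _ I x) | x in closure (V I)] `&`
    [set kproj (existT _ J x) | x in closure (V J)] !=set0 ->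
    (val I \subset val J) || (val J \subset val I);
  red_cover : range iotaK `<=` kproj @` family_set V
}.

Definition nested_reduction (C V : forall I : idx, set (U I)) : Prop :=
  [/\ is_reduction C, is_reduction V & forall I, precompact_in (C I) (V I)].

Section Perturbation.
Variable V : forall I : idx, set (U I).
(* only the restriction of [nu I] to [V I] is meaningful *)
Variable nu : forall I : idx, U I -> E I.
Arguments V I : clear implicits.
Arguments nu I _ : clear implicits.

Definition is_perturbation : Prop :=
  (forall I, smooth_vmap (kS (katlas_chart K I)) (V I) (nu I)) /\
  forall I J : idx, val I \proper val J ->
    forall x, V I x -> UU I J x -> V J (phi I J x) ->
      nu J (phi I J x) = hat I J (nu I x).

Definition perturbed (I : idx) (x : U I) : E I := ks x + nu I x.
Arguments perturbed I x : clear implicits.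

Definition zero_set (I : idx) : set (U I) := [set x | V I x /\ perturbed I x = 0].
Arguments zero_set I : clear implicits.

Definition transverse_perturbation : Prop :=
  forall (I : idx) (z : U I) c, zero_set I z ->
    charts (kS (katlas_chart K I)) c -> cdom c z ->
    limg (dvmap c (perturbed I) z) = fullv.

Definition precompact_perturbation : Prop :=
  exists2 C : forall I : idx, set (U I), nested_reduction C V &
    kproj @` family_set zero_set `<=` kproj @` family_set C.

Definition zsum : topologicalType := {I : idx & set_type (zero_set I)}.

Variant zstep : zsum -> zsum -> Prop :=
  ZStep (I J : idx) (x : set_type (zero_set I)) (y : set_type (zero_set J))
      of val I \proper val J & UU I J (set_val x)
       & phi I J (set_val x) = set_val y :
    zstep (existT _ I x) (existT _ J y).

Definition zspace : topologicalType := quotient_space zstep.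
Definition zproj : zsum -> zspace := @qproj _ zstep.

Definition zincl (w : zsum) : ksum :=
  existT _ (projT1 w) (set_val (projT2 w)).

(* The map from the abstract quotient to the realization induced by the
   inclusion of the zero sets. *)
Definition zmap (z : zspace) : realization :=
  kproj (zincl (repr (z : {eq_quot gen_equiv zstep}))).

Lemma zmap_proj (w : zsum) : zmap (zproj w) = kproj (zincl w).
Proof.
rewrite /zmap; set w' := repr _.
have : gen_equiv zstep w' w by apply/eqmodP; rewrite /w' reprK.
move=> /asboolP h; apply/eqmodP/asboolP; elim: h => {w'}.
- move=> _ _ [I J x y IJ Ux e]; rewrite /zincl /= -e.
  by apply: rst_step; exact: KStep.
- by move=> *; exact: rst_refl.
- by move=> *; exact: rst_sym.
- by move=> ? ? ? ? h1 ? h2; exact: rst_trans h1 h2.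
Qed.

(* [S] is the smooth structure on the quotient for which the zero sets, with
   their structures of embedded submanifolds, are open submanifolds. *)
Definition compatible_structure (S : smooth_structure R zspace d) : Prop :=
  exists SZ : forall I : idx, smooth_structure R (set_type (zero_set I)) d,
    forall I : idx,
      smooth_embedding (SZ I) (kS (katlas_chart K I)) setT
        (@set_val _ (zero_set I)) /\
      diffeo_onto_open (SZ I) S (fun x => zproj (existT _ I x)).

End Perturbation.
End Atlas.

(* Main.v *)
From HB Require Import structures.
From Stdlib Require Import Relation_Operators.
Require Import Defs.
From mathcomp Require Import all_boot all_order all_algebra.
From mathcomp Require Import generic_quotient ring lra.
From mathcomp Require Import all_classical all_reals all_analysis.
Set Implicit Arguments.
Unset Strict Implicit.
Unset Printing Implicit Defensive.
Import Order.TTheory GRing.Theory Num.Theory passmx.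
Import numFieldNormedType.Exports.
Local Open Scope classical_set_scope.
Local Open Scope ring_scope.

(* A zero set Z_I of a transverse section is a submanifold of U_I of dimension d,
   by the inverse function theorem. The coordinate changes restrict to injective
   immersions between manifolds of the same dimension d, hence to open maps, so
   that the Z_I embed as open subsets of |Z| with smooth transition maps.
   Tameness makes the equivalence relation on the U_I explicit: x in U_I and y in
   U_J are equivalent when both come from one point of U_(I ∩ J), or from one
   point of X when I and J are disjoint. This relation is closed in U_I x U_J.
   Hence |Z| is Hausdorff, and the image in |K| of a compact subset of U_I is
   closed. Precompactness covers |Z| by finitely many compact sets, the images of
   the points of Z_J in the closure of C_J; so |Z| is compact and the continuous
   bijection onto its image in |K| is a closed map. *)

(** * Calculus of functions of class [C^k] *)

(** Each [V I] is open, so a zero set is closed only relative to [V I], and its points may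
    accumulate at the boundary. Precompactness repairs this: every zero is equivalent to a point of
    some [C J]. Charts of a reduction that meet in the realization have comparable indices, so one
    coordinate change links the two points. Compatibility of the perturbation and injectivity of the
    maps on obstruction spaces carry zeros both forwards and backwards along it. The set I ∩ J
    enters through additivity: inside E_L the images of E_I and E_J meet in that of E_(I ∩ J).
    Closedness of the relation then rests on one consequence of tameness: the image of φ_HI is all
    of s_I^(-1)(E_H), a closed subset of U_I, although U_HI is merely open in U_H. For disjoint I
    and J only points with s = 0 can be equivalent, and the footprint maps into the Hausdorff space
    X decide. *)

Section CkAlgebra.
Context {R : realType}.
Implicit Types V W : normedModType R.

(** The first-order expansion at [x] depends only on the germ of the function, and uniqueness of the
    expansion identifies the two differentials. *)
Lemma near_eq_diff V W (f g : V -> W) x :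
  (\near x, f x = g x) -> differentiable f x ->
  differentiable g x /\ 'd g x = 'd f x :> (V -> W).
Proof.
move=> fg df; have dfc : continuous ('d f x) by exact: diff_continuous.
have key : g \o shift x = cst (g x) + 'd f x +o_ 0 id.
  apply/eqaddoP => e e0.
  have /eqaddoP/(_ _ e0) := diff_locally df.
  have : \forall h \near 0, f (h + x) = g (h + x).
    by move: fg; rewrite (near_shift 0) /=; apply: filterS => h; rewrite subr0.
  move=> fg0; apply: filterS2 fg0 => h /= E.
  rewrite -[(_ - _) h]/(f (h + x) - (f x + 'd f x h)).
  by rewrite E (nbhs_singleton fg).
have E := diff_unique dfc key; split=> //.
by apply/diff_locallyP; rewrite E.
Qed.

Lemma Ck_subset V W k (A B : set V) (f : V -> W) :
  B `<=` A -> Ck k A f -> Ck k B f.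
Proof.
move=> BA; elim: k f => [|k IH] f /=; first by move=> h x /BA /h.
by move=> [h1 h2]; split=> [x /BA /h1//|v]; exact: IH.
Qed.

Lemma Ck_eq V W k (A : set V) (f g : V -> W) : open A ->
  (forall x, A x -> f x = g x) -> Ck k A f -> Ck k A g.
Proof.
move=> oA; elim: k f g => [|k IH] f g fg.
  move=> h x Ax; have := h x Ax; rewrite /prop_for /continuous_at -(fg x Ax).
  apply: cvg_trans; apply: near_eq_cvg.
  by apply: filterS (open_nbhs_nbhs (conj oA Ax)) => y /fg ->.
have nfg x : A x -> \near x, f x = g x.
  by move=> Ax; apply: filterS (open_nbhs_nbhs (conj oA Ax)) => y /fg ->.
move=> [h1 h2]; split=> [x Ax|v].
  by have [] := near_eq_diff (nfg x Ax) (h1 x Ax).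
apply: IH (h2 v) => x Ax.
by have [_ ->] := near_eq_diff (nfg x Ax) (h1 x Ax).
Qed.

(** [Ck] imposes conditions on the total function [f] point by point, at every order. Hence [B] only
    has to contain [x]; it may differ from point to point and need not be open. *)
Lemma Ck_local V W k (A : set V) (f : V -> W) :
  (forall x, A x -> exists2 B : set V, B x & Ck k B f) -> Ck k A f.
Proof.
elim: k f => [|k IH] f h /=.
  by move=> x /h[B Bx]; exact.
split=> [x /h[B Bx []]|v]; first by move=> + _; apply.
by apply: IH => x /h[B Bx [_ hv]]; exists B => //; exact: hv.
Qed.

Lemma Ck_pred V W k (A : set V) (f : V -> W) : Ck k.+1 A f -> Ck k A f.
Proof.
elim: k f => [|k IH] f [h1 h2].
  by move=> x /h1; exact: differentiable_continuous.
by split=> // v; exact: IH.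
Qed.

Lemma Ck_continuous V W k (A : set V) (f : V -> W) : Ck k A f ->
  forall x, A x -> {for x, continuous f}.
Proof. by elim: k => // k IH /Ck_pred. Qed.

Lemma Ck_cst V W k (A : set V) (w : W) : Ck k A (fun=> w).
Proof.
elim: k w => [|k IH] w; first by move=> x _; exact: cst_continuous.
split=> [x _|v]; first exact: differentiable_cst.
rewrite (_ : (fun x => _) = fun=> 0) //; apply/funext => x.
by rewrite [LHS](congr1 (fun f => f v) (diff_cst w x)).
Qed.

Lemma Ck_lin V W k (A : set V) (f : {linear V -> W}) :
  continuous f -> Ck k A f.
Proof.
case: k => [|k] cf; first by move=> x _; exact: cf.
split=> [x _|v]; first exact: linear_differentiable.
rewrite (_ : (fun x => _) = fun=> f v); first exact: Ck_cst.
by apply/funext => x; rewrite diff_lin.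
Qed.

Lemma Ck_comp_lin V W W' k (A : set V) (f : V -> W) (L : {linear W -> W'}) :
  open A -> continuous L -> Ck k A f -> Ck k A (fun x => L (f x)).
Proof.
move=> oA cL; elim: k f => [|k IH] f.
  move=> h x /h cf; apply: (@continuous_comp _ _ _ f L) => //; exact: cL.
move=> [h1 h2]; have dL y : differentiable L y by exact: linear_differentiable.
split=> [x /h1 df|v]; first exact: (@differentiable_comp _ _ _ _ f L).
apply: Ck_eq (IH _ (h2 v)) => // x /h1 df.
by rewrite (@diff_comp _ _ _ _ f L)//= diff_lin.
Qed.

Lemma CkD V W k (A : set V) (f g : V -> W) : open A ->
  Ck k A f -> Ck k A g -> Ck k A (fun x => f x + g x).
Proof.
move=> oA; elim: k f g => [|k IH] f g.
  by move=> h h' x Ax; apply: continuousD; [exact: h|exact: h'].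
move=> [f1 f2] [g1 g2]; split=> [x Ax|v].
  by apply: differentiableD; [exact: f1|exact: g1].
apply: Ck_eq (IH _ _ (f2 v) (g2 v)) => // x Ax.
exact: esym (congr1 (@^~ v) (diffD (f1 x Ax) (g1 x Ax))).
Qed.

Lemma Ck_sum V W k (A : set V) (I : Type) (r : seq I) (F : I -> V -> W) :
  open A -> (forall i, Ck k A (F i)) -> Ck k A (fun x => \sum_(i <- r) F i x).
Proof.
move=> oA h; elim: r => [|i r IH].
  by under eq_fun do rewrite big_nil; exact: Ck_cst.
by under eq_fun do rewrite big_cons; exact: CkD.
Qed.

Lemma CkZl V W k (A : set V) (u : V -> R) (w : W) : open A ->
  Ck k A u -> Ck k A (fun x => u x *: w).
Proof.
move=> oA; elim: k u => [|k IH] u.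
  by move=> h x Ax; apply: continuousZr_tmp; exact: h.
move=> [h1 h2]; split=> [x /h1|v]; first exact: differentiableZl.
by apply: Ck_eq (IH _ (h2 v)) => // x /h1 du; rewrite diffZl.
Qed.

Lemma CkM V k (A : set V) (f g : V -> R) : open A ->
  Ck k A f -> Ck k A g -> Ck k A (fun x => f x * g x).
Proof.
move=> oA; elim: k f g => [|k IH] f g.
  by move=> h h' x Ax; apply: continuousM; [exact: h|exact: h'].
move=> fS gS; have fk := Ck_pred fS; have gk := Ck_pred gS.
move: fS gS => [f1 f2] [g1 g2]; split=> [x Ax|v].
  by apply: differentiableM; [exact: f1|exact: g1].
apply: Ck_eq (CkD oA (IH _ _ fk (g2 v)) (IH _ _ gk (f2 v))) => // x Ax.
exact: esym (congr1 (@^~ v) (diffM (f1 x Ax) (g1 x Ax))).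
Qed.

Lemma Ck_prod V k (A : set V) (I : Type) (r : seq I) (F : I -> V -> R) :
  open A -> (forall i, Ck k A (F i)) -> Ck k A (fun x => \prod_(i <- r) F i x).
Proof.
move=> oA h; elim: r => [|i r IH].
  by under eq_fun do rewrite big_nil; exact: Ck_cst.
by under eq_fun do rewrite big_cons; exact: CkM.
Qed.

Lemma CkN V W k (A : set V) (f : V -> W) : open A ->
  Ck k A f -> Ck k A (fun x => - f x).
Proof.
move=> oA; elim: k f => [|k IH] f.
  by move=> h x Ax; apply: continuousN; exact: h.
move=> [f1 f2]; split=> [x Ax|v].
  by apply: differentiableN; exact: f1.
by apply: Ck_eq (IH _ (f2 v)) => // x Ax;
  exact: esym (congr1 (@^~ v) (diffN (f1 x Ax))).
Qed.

Lemma CkV V k (A : set V) (f : V -> R) : open A ->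
  (forall x, A x -> f x != 0) -> Ck k A f -> Ck k A (fun x => (f x)^-1).
Proof.
move=> oA f0; elim: k f f0 => [|k IH] f f0.
  by move=> h x Ax; apply: continuousV; [exact: f0|exact: h].
move=> fS; have fk := IH _ f0 (Ck_pred fS).
move: fS => [f1 f2]; split=> [x Ax|v].
  by apply: differentiableV; [exact: f1|exact: f0].
apply: Ck_eq (CkN oA (CkM oA (CkM oA fk fk) (f2 v))) => // x Ax.
rewrite [RHS](congr1 (@^~ v) (diffV (f1 x Ax) (f0 x Ax))).
by rewrite -[RHS]/(- f x ^- 2 * 'd f x v) mulNr -exprVn expr2.
Qed.

End CkAlgebra.

(** * Calculus on row vectors: chain rule, determinants and inverse matrices *)

Section CkRow.
Context {R : realType}.
Implicit Types V W : normedModType R.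

Lemma linear_rV W n (L : {linear 'rV[R]_n -> W}) u :
  L u = \sum_i u 0 i *: L (delta_mx 0 i).
Proof.
by rewrite {1}(row_sum_delta u) linear_sum; apply: eq_bigr => i _; rewrite linearZ.
Qed.

Lemma continuous_linear_rV W n (L : {linear 'rV[R]_n -> W}) : continuous L.
Proof.
rewrite (_ : (L : _ -> _) = fun u => \sum_i u 0 i *: L (delta_mx 0 i)); last first.
  by apply/funext => u; exact: linear_rV.
have h : Ck 0 setT (fun u : 'rV[R]_n => \sum_i u 0 i *: L (delta_mx 0 i)).
  apply: Ck_sum => [|i]; first exact: openT.
  by apply: CkZl => [|u _]; [exact: openT|exact: coord_continuous].
by move=> x; exact: h.
Qed.

Fact row_coord_linear n (i : 'I_n) : linear (fun u : 'rV[R]_n => u 0 i : R).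
Proof. by move=> a u v; rewrite !mxE. Qed.

Definition row_coord n (i : 'I_n) : {linear 'rV[R]_n -> R} :=
  HB.pack (fun u : 'rV[R]_n => u 0 i : R)
    (GRing.isLinear.Build _ _ _ _ _ (row_coord_linear i)).

Lemma Ck_coord V n k (A : set V) (f : V -> 'rV[R]_n) i : open A ->
  Ck k A f -> Ck k A (fun x => f x 0 i).
Proof.
move=> oA; apply: (Ck_comp_lin (L := row_coord i)) => //.
exact: continuous_linear_rV.
Qed.

Lemma Ck_rV V n k (A : set V) (f : V -> 'rV[R]_n) : open A ->
  (forall i, Ck k A (fun x => f x 0 i)) -> Ck k A f.
Proof.
move=> oA h; rewrite (_ : f = fun x => \sum_i f x 0 i *: delta_mx 0 i).
  by apply: Ck_sum => // i; exact: CkZl.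
by apply/funext => x; exact: row_sum_delta.
Qed.

Lemma diff_coord V n (f : V -> 'rV[R]_n) i x v : differentiable f x ->
  'd (fun y => f y 0 i : R) x v = 'd f x v 0 i.
Proof.
move=> df; have cL : continuous (row_coord i) by exact: continuous_linear_rV.
have dL : differentiable (row_coord i) (f x) by exact: linear_differentiable.
transitivity ('d (row_coord i) (f x) ('d f x v)); last by rewrite diff_lin.
exact: (congr1 (@^~ v) (diff_comp df dL)).
Qed.

(** Keeping [g] scalar makes the induction close: the chain rule expands the derivative into
    products of coordinates of ['d f x v] with partial derivatives of [g] composed with [f], which
    are again composites of the same kind. *)
Lemma Ck_comp1 V n k (A : set V) (B : set 'rV[R]_n)
    (f : V -> 'rV[R]_n) (g : 'rV[R]_n -> R) : open A ->
  (forall x, A x -> B (f x)) -> Ck k A f -> Ck k B g -> Ck k A (g \o f).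
Proof.
move=> oA AB; elim: k f g AB => [|k IH] f g AB.
  move=> h h' x Ax; apply: continuous_comp; first exact: h.
  exact: h' (AB x Ax).
move=> fS [g1 g2]; have fk := Ck_pred fS; move: fS => [f1 f2].
split=> [x Ax|v].
  by apply: differentiable_comp; [exact: f1|exact: g1 (AB x Ax)].
have S i : Ck k A (fun x => 'd f x v 0 i * 'd g (f x) (delta_mx 0 i)).
  apply: CkM => //; first exact: (Ck_coord i oA (f2 v)).
  exact: (IH f (fun y => 'd g y (delta_mx 0 i)) AB fk (g2 _)).
apply: Ck_eq (Ck_sum (index_enum _) oA S) => // x Ax.
rewrite [RHS](congr1 (@^~ v) (diff_comp (f1 x Ax) (g1 _ (AB x Ax)))) /=.
by rewrite [RHS]linear_rV.
Qed.

Lemma Ck_comp V n m k (A : set V) (B : set 'rV[R]_n)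
    (f : V -> 'rV[R]_n) (g : 'rV[R]_n -> 'rV[R]_m) : open A -> open B ->
  (forall x, A x -> B (f x)) -> Ck k A f -> Ck k B g -> Ck k A (g \o f).
Proof.
move=> oA oB AB fk gk; apply: Ck_rV => // i.
exact: (Ck_comp1 (g := fun y => g y 0 i) oA AB fk (Ck_coord i oB gk)).
Qed.

Lemma Ck_det V n k (A : set V) (M : V -> 'M[R]_n) : open A ->
  (forall i j, Ck k A (fun x => M x i j)) -> Ck k A (fun x => \det (M x)).
Proof.
move=> oA h; rewrite /determinant; apply: Ck_sum => // s.
by apply: CkM => //; [exact: Ck_cst|exact: Ck_prod].
Qed.

(** Cramer's rule: the entries are cofactors divided by the determinant. *)
Lemma Ck_invmx V n k (A : set V) (M : V -> 'M[R]_n) : open A ->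
  (forall x, A x -> M x \in unitmx) ->
  (forall i j, Ck k A (fun x => M x i j)) ->
  forall i j, Ck k A (fun x => invmx (M x) i j).
Proof.
move=> oA uM h i j.
have S : Ck k A (fun x => (\det (M x))^-1 *
                   ((-1) ^+ (j + i) * \det (row' j (col' i (M x))))).
  apply: CkM => //.
    apply: CkV => //; last exact: Ck_det.
    by move=> x /uM; rewrite unitmxE unitfE.
  apply: CkM => //; first exact: Ck_cst.
  by apply: Ck_det => // a b; under eq_fun do rewrite !mxE; exact: h.
by apply: Ck_eq S => // x /uM u; rewrite /invmx u !mxE.
Qed.

Section Smooth.
Variables (V : normedModType R).

Lemma smooth_subset W (A B : set V) (f : V -> W) :
  B `<=` A -> smooth_on A f -> smooth_on B f.
Proof. by move=> BA h k; exact: Ck_subset (h k). Qed.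

Lemma smooth_eq W (A : set V) (f g : V -> W) : open A ->
  (forall x, A x -> f x = g x) -> smooth_on A f -> smooth_on A g.
Proof. by move=> oA fg h k; exact: Ck_eq (h k). Qed.

Lemma smooth_local W (A : set V) (f : V -> W) :
  (forall x, A x -> exists2 B : set V, B x & smooth_on B f) -> smooth_on A f.
Proof. by move=> h k; apply: Ck_local => x /h[B Bx s]; exists B. Qed.

Lemma smooth_continuous W (A : set V) (f : V -> W) x :
  smooth_on A f -> A x -> {for x, continuous f}.
Proof. by move=> /(_ 0)/Ck_continuous h /h. Qed.

Lemma smooth_diff W (A : set V) (f : V -> W) x :
  smooth_on A f -> A x -> differentiable f x.
Proof. by move=> /(_ 1)[h _] /h. Qed.

Lemma smooth_comp n m (A : set V) (B : set 'rV[R]_n)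
    (f : V -> 'rV[R]_n) (g : 'rV[R]_n -> 'rV[R]_m) : open A -> open B ->
  (forall x, A x -> B (f x)) -> smooth_on A f -> smooth_on B g ->
  smooth_on A (g \o f).
Proof. by move=> oA oB AB fs gs k; exact: Ck_comp (fs k) (gs k). Qed.

End Smooth.

Lemma smooth_linear W n (A : set 'rV[R]_n) (L : {linear 'rV[R]_n -> W}) :
  smooth_on A L.
Proof. by move=> k; apply: Ck_lin; exact: continuous_linear_rV. Qed.

End CkRow.

(** * The inverse function theorem *)

Section MeanValue.
Context {R : realType}.

Lemma normr_row_coord n (u : 'rV[R]_n) i : `|u 0 i| <= `|u|.
Proof.
rewrite [leRHS]/Num.Def.normr /= mx_normrE.
exact: (le_bigmax _ (fun j : 'I_1 * 'I_n => `|u j.1 j.2|) (0, i)).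
Qed.

Lemma normr_row_le n (u : 'rV[R]_n) (C : R) : 0 <= C ->
  (forall i, `|u 0 i| <= C) -> `|u| <= C.
Proof.
move=> C0 h; rewrite [leLHS]/Num.Def.normr /= mx_normrE.
by apply: bigmax_le => // -[i j] _ /=; rewrite ord1.
Qed.

(** The norm of a row vector is the maximum of its coordinates, so the scalar mean value theorem on
    the segment from [y] to [x], applied to each coordinate, suffices. *)
Lemma mean_value_ineq (V : normedModType R) m (f : V -> 'rV[R]_m) (B : set V)
    (C : R) : 0 <= C ->
  (forall x y t, B x -> B y -> 0 <= t <= 1 -> B (t *: (x - y) + y)) ->
  (forall x, B x -> differentiable f x) ->
  (forall x v, B x -> `|'d f x v| <= C * `|v|) ->
  forall x y, B x -> B y -> `|f x - f y| <= C * `|x - y|.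
Proof.
move=> C0 cvx df dC x y Bx By; apply: normr_row_le; first exact: mulr_ge0.
move=> i; pose p (t : R) := t *: (x - y) + y.
have dp t : differentiable p t.
  by apply: differentiableD; [exact: differentiableZl|exact: differentiable_cst].
have dp1 t : 'd p t 1 = x - y.
  rewrite [LHS](congr1 (@^~ 1) (diffD (f := fun s : R => s *: (x - y))
    (differentiableZl _ _) (differentiable_cst _ _))) //=.
  rewrite diffZl // [X in _ + X](congr1 (@^~ (1 : R)) (diff_cst y t)) addr0.
  by rewrite diff_val scale1r.
have Bp (t : R) : 0 <= t <= 1 -> B (p t) by exact: cvx.
have D (t : R) : 0 <= t <= 1 ->
    is_derive t 1 (fun s => f (p s) 0 i : R) ('d f (p t) (x - y) 0 i).
  move=> /Bp Bpt; have dfp : differentiable (f \o p) t.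
    by apply: differentiable_comp => //; exact: df.
  have dfpi : differentiable (fun s => (f \o p) s 0 i : R) t.
    exact: (differentiable_comp dfp (differentiable_coord _ _ _)).
  apply: DeriveDef; first exact/derivable1_diffP.
  rewrite deriveE // (diff_coord i (1 : R) dfp).
  rewrite (congr1 (@^~ (1 : R)) (diff_comp (dp t) (df _ Bpt))) /=.
  by rewrite dp1.
have [||t t01 E] := @MVT R (fun s => f (p s) 0 i)
    (fun t => 'd f (p t) (x - y) 0 i) 0 1 ltr01.
- by move=> t; rewrite in_itv /= => /andP[t0 t1]; apply: D; rewrite !ltW.
- apply/subspace_continuousP => t /=; rewrite in_itv /= => t01.
  have /derivable1_diffP/differentiable_continuous : derivable
    (fun s => f (p s) 0 i : R) t 1 by have [] := D t t01.
  exact: cvg_within_filter.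
have -> : (f x - f y) 0 i = 'd f (p t) (x - y) 0 i.
  by rewrite !mxE -[RHS]mulr1 -[X in _ * X](subr0 1) -E /p scale1r scale0r add0r subrK.
apply: le_trans (normr_row_coord _ _) (dC _ _ _); apply: Bp.
by move: t01; rewrite in_itv /= => /andP[t0 t1]; rewrite !ltW.
Qed.


Lemma linear_bound n m (M : {linear 'rV[R]_m -> 'rV[R]_n}) :
  exists2 k : R, 0 < k & forall w, `|M w| <= k * `|w|.
Proof. exact/linear_lipschitz/continuous_linear_rV. Qed.

(* Newton's map [x - M (f x)] is a contraction near [a] as soon as [M] is a
   left inverse of the differential at [a]. *)
Lemma newton_diff_small n m (A : set 'rV[R]_n) (f : 'rV[R]_n -> 'rV[R]_m) a
    (M : {linear 'rV[R]_m -> 'rV[R]_n}) : open A -> smooth_on A f -> A a ->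
  cancel ('d f a) M ->
  exists r : R, [/\ 0 < r, ball a r `<=` A &
    forall x v, ball a r x -> `|v - M ('d f x v)| <= 2^-1 * `|v|].
Proof.
move=> oA sf Aa fK; have [k k0 Mk] := linear_bound M.
(* Summing over the [n] basis vectors bounds the error by [k * n * e] times the norm of [v], which
   must be at most one half of it. Taking [n.+1] keeps [e] meaningful for [n = 0]. *)
pose e : R := (2 * k * n.+1%:R)^-1.
have e0 : 0 < e by rewrite invr_gt0 !mulr_gt0.
have : \forall x \near a, A x /\ 
   forall i, `|'d f a (delta_mx 0 i) - 'd f x (delta_mx 0 i)| <= e.
  near=> x; split; first by near: x; exact: open_nbhs_nbhs.
  near: x; apply: filter_forall => i.
  have [_ cf] := sf 1; have := cf (delta_mx 0 i) a Aa.
  by move=> /cvgrPdist_le/(_ _ e0).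
move=> /nbhs_ballP[r r0 h]; exists r; split=> // [x /h[]//|x v /h[Ax {}h]].
rewrite -{1}(fK v) -linearB; apply: le_trans (Mk _) _.
have -> : 'd f a v - 'd f x v = \sum_i (v 0 i *: 'd f a (delta_mx 0 i) -
    v 0 i *: 'd f x (delta_mx 0 i)).
  by rewrite sumrB; congr (_ - _); exact: linear_rV.
have S : `|\sum_i (v 0 i *: 'd f a (delta_mx 0 i) - v 0 i *: 'd f x (delta_mx 0 i))|
    <= n%:R * e * `|v|.
  apply: le_trans (ler_norm_sum _ _ _) _.
  apply: le_trans (_ : \sum_(i < n) e * `|v| <= _); last first.
    by rewrite sumr_const card_ord -mulrA mulr_natl.
  apply: ler_sum => i _; rewrite -scalerBr normrZ mulrC.
  by apply: ler_pM => //; exact: normr_row_coord.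
apply: le_trans (_ : k * (n%:R * e * `|v|) <= _); first exact: ler_wpM2l (ltW k0) _ _ S.
rewrite !mulrA ler_wpM2r // /e !invfM.
rewrite [leLHS](_ : _ = 2^-1 * (n%:R / n.+1%:R)); last first.
  have : n.+1%:R != 0 :> R by rewrite pnatr_eq0.
  by move: (n.+1%:R : R) (lt0r_neq0 k0) => N *; field; apply/andP.
rewrite ler_piMr // ler_pdivrMr // mul1r ler_nat.
exact: leqnSn.
Unshelve. all: by end_near. Qed.

End MeanValue.

(** * Consequences of the contraction property of Newton's map *)

Section NewtonMap.
Context {R : realType}.

Section Local.
Variables (n m : nat) (f : 'rV[R]_n -> 'rV[R]_m) (a : 'rV[R]_n) (r : R).
Variable M : {linear 'rV[R]_m -> 'rV[R]_n}.
Hypothesis df : forall x, ball a r x -> differentiable f x.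
Hypothesis dM : forall x v, ball a r x -> `|v - M ('d f x v)| <= 2^-1 * `|v|.

Lemma newton_diff_inj x v : ball a r x -> 'd f x v = 0 -> v = 0.
Proof.
move=> Bx fv; have := dM v Bx; rewrite fv linear0 subr0 => h.
apply/eqP; rewrite -normr_le0; have := normr_ge0 v; lra.
Qed.

Lemma newton_contraction x y : ball a r x -> ball a r y ->
  `|(x - y) - M (f x - f y)| <= 2^-1 * `|x - y|.
Proof.
move=> Bx By; have dL : forall u, differentiable M u.
  by move=> u; apply: linear_differentiable; exact: continuous_linear_rV.
pose h u := u - M (f u).
have dMf u : ball a r u -> differentiable (M \o f) u.
  by move=> Bu; apply: differentiable_comp => //; exact: df.
have -> : x - y - M (f x - f y) = h x - h y.
  by rewrite /h linearB; apply/rowP => i; rewrite !mxE; ring.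
apply: (@mean_value_ineq _ _ _ h (ball a r)) => //.
- move=> {x y Bx By} x y t; rewrite -ball_normE /= => Bx By /andP[t0 t1].
  have -> : a - (t *: (x - y) + y) = t *: (a - x) + (1 - t) *: (a - y).
    by apply/rowP => i; rewrite !mxE; ring.
  apply: le_lt_trans (ler_normD _ _) _; rewrite !normrZ !ger0_norm ?subr_ge0 //.
  (* The strict inequality is taken from the term with factor [t], so [t = 0] is separate. *)
  have [tp|tn] := ltP 0 t; last first.
    by rewrite (_ : t = 0) ?mul0r ?subr0 ?mul1r ?add0r //; lra.
  have : t * `|a - x| < t * r by rewrite ltr_pM2l.
  have : (1 - t) * `|a - y| <= (1 - t) * r by rewrite ler_wpM2l ?subr_ge0 // ltW.
  by lra.
- by move=> u Bu; apply: differentiableB => //; exact: dMf.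
- move=> u v Bu; have Lu : 'd h u v = v - M ('d f u v); last by rewrite Lu; exact: dM.
  have did : differentiable (id : 'rV[R]_n -> _) u by [].
  transitivity ('d id u v - 'd (M \o f) u v).
    exact: (congr1 (@^~ v) (diffB did (dMf u Bu))).
  congr (_ - _).
    have Eid : 'd id u = id :> ('rV[R]_n -> _) by exact: diff_val.
    by rewrite Eid.
  transitivity ('d M (f u) ('d f u v)).
    exact: (congr1 (@^~ v) (diff_comp (df Bu) (dL _))).
  by rewrite diff_lin //; exact: continuous_linear_rV.
Qed.

(** The contraction absorbs half of the distance between [x] and [y], and [M (f x - f y)] must
    account for the other half. This yields both local injectivity and a Lipschitz bound for the
    inverse. *)
Lemma newton_expand (k : R) : 0 < k -> (forall w, `|M w| <= k * `|w|) ->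
  forall x y, ball a r x -> ball a r y -> `|x - y| <= 2 * k * `|f x - f y|.
Proof.
move=> k0 Mk x y Bx By; have := newton_contraction Bx By.
have := Mk (f x - f y); have := ler_normD (x - y - M (f x - f y)) (M (f x - f y)).
by rewrite subrK; lra.
Qed.

(** Compactness replaces the iteration: the norm of [M (f x - y)] attains its minimum on the closed
    ball, and one Newton step [T] at most halves it, so the minimum is zero. The bound on
    [M (y - f x0)] is what keeps [T x] inside the ball. *)
Lemma newton_surj x0 (rho : R) y : injective M ->
  (forall x, `|x - x0| <= rho -> ball a r x) -> 0 <= rho ->
  `|M (y - f x0)| <= 2^-1 * rho -> exists2 x, `|x - x0| <= rho & f x = y.
Proof.
move=> Minj sub rho0 yM; pose B := [set x : 'rV[R]_n | `|x - x0| <= rho].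
have Bx0 : B x0 by rewrite /B /= subrr normr0.
pose T x := x - M (f x - y).
have cB : compact B.
  rewrite (_ : B = closed_ball_ Num.norm x0 rho); last first.
    by apply/seteqP; split => x /=; rewrite /B /= distrC.
  apply: bounded_closed_compact; last exact: closed_closed_ball_.
  exists (rho + `|x0|); split; first exact: num_real.
  move=> b hb x /=; rewrite /closed_ball_ /= => hx.
  by have := ler_normB x0 (x0 - x); rewrite opprB addrC subrK; lra.
have cphi : {within B, continuous (fun x => `|M (f x - y)|)}.
  apply/continuous_in_subspaceT => x; rewrite inE => /sub Bx.
  apply: continuous_comp; last exact: norm_continuous.
  apply: continuous_comp; last exact: continuous_linear_rV.
  apply: continuousB; last exact: cst_continuous.
  exact/differentiable_continuous/df.
have [x xB xmin] := compact_EVT_min (ex_intro _ x0 Bx0) cB cphi.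
have {xB} Bx : B x by rewrite inE in xB.
have BT : B (T x).
  have := newton_contraction (sub _ Bx) (sub _ Bx0).
  have := ler_normD (x - x0 - M (f x - f x0)) (M (y - f x0)).
  have -> : x - x0 - M (f x - f x0) + M (y - f x0) = T x - x0.
    by rewrite /T !linearB; apply/rowP => i; rewrite !mxE; ring.
  rewrite /B /=; move: Bx; rewrite /B /= => Bx; lra.
have := xmin (T x); rewrite inE => /(_ BT).
have := newton_contraction (sub _ BT) (sub _ Bx).
have -> : T x - x = - M (f x - y) by rewrite /T addrAC subrr add0r.
have -> : - M (f x - y) - M (f (T x) - f x) = - M (f (T x) - y).
  by rewrite !linearB; apply/rowP => i; rewrite !mxE; ring.
rewrite !normrN => h1 h2.
have h0 : M (f x - y) = 0.
  by apply/eqP; rewrite -normr_le0; have := normr_ge0 (M (f x - y)); lra.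
exists x => //; apply/eqP; rewrite -subr_eq0; apply/eqP/Minj.
by rewrite h0 linear0.
Qed.

End Local.

End NewtonMap.

(** * Openness of the image and smoothness of the inverse *)

Section InverseFunction.
Context {R : realType}.

Lemma diff_eps (V W : normedModType R) (f : V -> W) x : differentiable f x ->
  forall e, 0 < e ->
  \forall z \near x, `|f z - f x - 'd f x (z - x)| <= e * `|z - x|.
Proof.
move=> df e e0; have /eqaddoP/(_ _ e0) := diff_locally df.
rewrite [X in _ -> X](near_shift 0) /=; apply: filterS => z /=.
by rewrite subr0 addrK -[(_ - _) z]/(f (z + x) - (f x + 'd f x z)) opprD addrA.
Qed.

Lemma eps_diff (V W : normedModType R) (f : V -> W) x (M : {linear V -> W}) :
  continuous M ->
  (forall e, 0 < e -> \forall z \near x, `|f z - f x - M (z - x)| <= e * `|z - x|) ->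
  differentiable f x /\ 'd f x = M :> (V -> W).
Proof.
move=> cM h; suff key : f \o shift x = cst (f x) + M +o_ 0 id.
  have E := diff_unique cM key; split=> //.
  by apply/diff_locallyP; rewrite E.
apply/eqaddoP => e /h; rewrite (near_shift 0) /=; apply: filterS => z /=.
by rewrite subr0 addrK -[(_ - _) z]/(f (z + x) - (f x + M z)) opprD addrA.
Qed.

Lemma jacobianE n m (f : 'rV[R]_n -> 'rV[R]_m) a v : v *m 'J f a = 'd f a v.
Proof. exact: mul_rV_lin1. Qed.

Lemma diff_inj_unit n (f : 'rV[R]_n -> 'rV[R]_n) a :
  (forall v, 'd f a v = 0 -> v = 0) -> 'J f a \in unitmx.
Proof.
move=> h; rewrite -row_free_unit; apply: inj_row_free => v.
by rewrite jacobianE => /h.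
Qed.

Section Fix.
Variables (n : nat) (A : set 'rV[R]_n) (f : 'rV[R]_n -> 'rV[R]_n).
Hypothesis oA : open A.
Hypothesis sf : smooth_on A f.
Hypothesis df_inj : forall a v, A a -> 'd f a v = 0 -> v = 0.

Let unitJ a : A a -> 'J f a \in unitmx.
Proof. by move=> Aa; apply: diff_inj_unit => v; exact: df_inj. Qed.

Let newton_ball a : A a -> exists r : R, [/\ 0 < r, ball a r `<=` A &
  forall x v, ball a r x ->
    `|v - mulmxr (invmx ('J f a)) ('d f x v)| <= 2^-1 * `|v|].
Proof.
move=> Aa; apply: newton_diff_small => // v /=.
by rewrite -jacobianE mulmxK // unitJ.
Qed.

Lemma inverse_function_open (B : set 'rV[R]_n) : open B -> B `<=` A ->
  open (f @` B).
Proof.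
move=> oB BA; rewrite openE => _ [a Ba <-].
have [r [r0 rA hr]] := newton_ball (BA _ Ba).
have df x : ball a r x -> differentiable f x by move=> /rA; exact: smooth_diff.
have /nbhs_ballP[s s0 hs] := open_nbhs_nbhs (conj oB Ba).
have [k k0 Mk] := linear_bound (mulmxr (invmx ('J f a)) : {linear 'rV[R]_n -> 'rV[R]_n}).
(* Halving puts the closed ball of radius [rho] inside both open balls: the Newton estimate holds in
   the first, and the second lies in [B]. *)
pose rho := Num.min r s / 2.
have m0 : 0 < Num.min r s by rewrite lt_min r0.
have rho0 : 0 < rho by rewrite divr_gt0.
have sub (x : 'rV[R]_n) : `|x - a| <= rho -> ball a r x /\ ball a s x.
  move=> h; have : `|a - x| < Num.min r s.
    by rewrite distrC; apply: le_lt_trans h _; rewrite /rho; lra.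
  by rewrite lt_min -ball_normE => /andP.
(* As [M] stretches by at most [k], this radius gives the bound [rho / 2] that [newton_surj]
   requires. *)
apply/nbhs_ballP; exists (rho / (2 * k)); first by rewrite /= divr_gt0 // mulr_gt0.
move=> y; rewrite -ball_normE /= distrC => hy.
have [||||x xa fx] := newton_surj df hr (x0 := a) (rho := rho) (y := y).
- move=> u v /= /(congr1 (fun w => w *m 'J f a)).
  by rewrite !mulmxKV ?unitJ // ; exact: BA.
- by move=> x /sub[].
- exact: ltW.
- apply: le_trans (Mk _) _; apply: le_trans (_ : k * (rho / (2 * k)) <= _).
    by apply: ler_wpM2l; exact: ltW.
  rewrite le_eqVlt; apply/orP; left; apply/eqP.
  by move: (lt0r_neq0 k0) => *; field.
by exists x => //; apply: hs; have [] := sub x xa.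
Qed.

Lemma inverse_function_local_inj a : A a ->
  exists r : R, [/\ 0 < r, ball a r `<=` A &
    forall x y, ball a r x -> ball a r y -> f x = f y -> x = y].
Proof.
move=> Aa; have [r [r0 rA hr]] := newton_ball Aa; exists r; split=> // x y Bx By fxy.
have df z : ball a r z -> differentiable f z by move=> /rA; exact: smooth_diff.
have [k k0 Mk] := linear_bound (mulmxr (invmx ('J f a)) : {linear 'rV[R]_n -> 'rV[R]_n}).
have := newton_expand df hr k0 Mk Bx By.
by rewrite fxy subrr normr0 mulr0 normr_le0 subr_eq0 => /eqP.
Qed.

Section Inverse.
Variable g : 'rV[R]_n -> 'rV[R]_n.
Hypothesis gf : forall x, A x -> g (f x) = x.

Let near_image x (P : set 'rV[R]_n) : A x -> nbhs x P ->
  \forall y \near f x, [/\ A (g y), P (g y) & f (g y) = y].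
Proof.
move=> Ax; rewrite nbhsE => -[N [oN Nx] NP].
have oi : open (f @` (N `&` A)).
  by apply: inverse_function_open; [exact: openI|exact: subIsetr].
have fx : (f @` (N `&` A)) (f x) by exists x.
apply: filterS (open_nbhs_nbhs (conj oi fx)) => _ [u [Nu Au] <-].
by rewrite gf //; split => //; exact: NP.
Qed.

Let inverse_continuous x : A x -> {for f x, continuous g}.
Proof.
move=> Ax N; rewrite gf // => Nx.
by apply: filterS (near_image Ax Nx) => y [].
Qed.

Let inverse_diff x : A x -> differentiable g (f x) /\
  'd g (f x) = mulmxr (invmx ('J f x)) :> ('rV[R]_n -> 'rV[R]_n).
Proof.
move=> Ax; pose M : {linear 'rV[R]_n -> 'rV[R]_n} := mulmxr (invmx ('J f x)).
have cM : continuous M by exact: continuous_linear_rV.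
apply: eps_diff => // e e0.
have [r [r0 rA hr]] := newton_ball Ax.
have df z : ball x r z -> differentiable f z by move=> /rA; exact: smooth_diff.
have [k k0 Mk] := linear_bound M.
(* One factor [k] is lost in applying [M], and [2 * k] in replacing the distance of [u] and [x] by
   that of [f u] and [f x] through [newton_expand]. *)
pose c := e / (2 * k * k).
have c0 : 0 < c by rewrite divr_gt0 // !mulr_gt0.
have fx := diff_eps (smooth_diff sf Ax) c0.
have Bx : nbhs x (ball x r) by exact: nbhsx_ballx.
apply: filterS (near_image Ax (filterI Bx fx)) => y [Ay [By]].
rewrite gf //; move: (g y) Ay By => u Au Bu + fu; rewrite -fu => h.
have /= E := newton_expand df hr k0 Mk Bu (ballxx _ r0).
have uxM : u - x = M ('d f x (u - x)) by rewrite /M /= -jacobianE mulmxK // unitJ.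
have -> : u - x - M (f u - f x) = - M (f u - f x - 'd f x (u - x)).
  transitivity (M ('d f x (u - x)) - M (f u - f x)); first by rewrite -uxM.
  have MB p q : M p - M q = - M (q - p) by rewrite linearB opprB.
  exact: MB.
rewrite normrN; apply: le_trans (Mk _) _.
apply: le_trans (ler_wpM2l (ltW k0) h) _.
apply: le_trans (_ : k * (c * (2 * k * `|f u - f x|)) <= _).
  by rewrite !ler_wpM2l // ltW.
rewrite [leLHS](_ : _ = e * `|f u - f x|) //.
by rewrite /c; move: (lt0r_neq0 k0) => *; field.
Qed.

(** Bootstrapping: the differential of [g] at [y] is the inverse Jacobian of [f] at [g y], which is
    of class C^k as soon as [g] is. *)
Let inverse_Ck k : Ck k (f @` A) g.
Proof.
have oi : open (f @` A) by exact: inverse_function_open.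
elim: k => [|k IH]; first by move=> _ [x Ax <-]; exact: inverse_continuous.
split=> [_ [x Ax <-]|v]; first by have [] := inverse_diff Ax.
have S : Ck k (f @` A) (fun y => v *m invmx ('J f (g y))).
  apply: Ck_rV => // j; under eq_fun do rewrite mxE.
  apply: Ck_sum => // i; apply: CkM => //; first exact: Ck_cst.
  apply: (Ck_invmx (M := fun y => 'J f (g y))) => //.
    by move=> _ [x Ax <-]; rewrite gf // unitJ.
  move=> p q; under eq_fun do rewrite mxE.
  apply: (Ck_comp1 (B := A) (g := fun x => 'd f x (delta_mx 0 p) 0 q) oi _ IH).
    by move=> _ [x Ax <-]; rewrite gf //; exact: Ax.
  by have [_ h] := sf k.+1; exact: (Ck_coord q oA (h _)).
apply: Ck_eq S => // _ [x Ax <-].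
by have [_ ->] := inverse_diff Ax; rewrite /= gf.
Qed.

Lemma inverse_function_smooth : smooth_on (f @` A) g.
Proof. by move=> k; exact: inverse_Ck. Qed.

End Inverse.
End Fix.
End InverseFunction.

(** * Straightening the zero set of a submersion *)

Section ImplicitFunction.
Context {R : realType}.

Lemma smooth_linear_comp n m p (A : set 'rV[R]_n) (f : 'rV[R]_n -> 'rV[R]_m)
    (L : {linear 'rV[R]_m -> 'rV[R]_p}) :
  open A -> smooth_on A f -> smooth_on A (fun x => L (f x)).
Proof.
move=> oA sf k; apply: Ck_comp_lin => //; exact: continuous_linear_rV.
Qed.

Lemma diff_linear_comp n m p (f : 'rV[R]_n -> 'rV[R]_m)
    (L : {linear 'rV[R]_m -> 'rV[R]_p}) x v : differentiable f x ->
  'd (fun y => L (f y)) x v = L ('d f x v).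
Proof.
move=> df; have cL : continuous L by exact: continuous_linear_rV.
have dL : differentiable L (f x) by exact: linear_differentiable.
transitivity ('d L (f x) ('d f x v)); last by rewrite diff_lin.
exact: (congr1 (@^~ v) (diff_comp df dL)).
Qed.

(** In the coordinates [v *m col_ebase J] the matrix [J] sees exactly the first [e] entries; [P]
    reads off the remaining [m], so together they determine [v]. *)
Lemma row_full_complement e m (J : 'M[R]_(e + m, e)) : row_full J ->
  exists P : 'M[R]_(e + m, m), forall v : 'rV_(e + m), v *m J = 0 -> v *m P = 0 -> v = 0.
Proof.
move=> fJ; exists (col_ebase J *m col_mx 0 1%:M) => v.
rewrite -{1}(mulmx_ebase J) (eqP fJ) !mulmxA.
set u := v *m _ => h1 h2; have uC : v = u *m invmx (col_ebase J).
  by rewrite /u mulmxK // col_ebase_unit.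
rewrite uC (_ : u = 0) ?mul0mx //.
move: h1 => /(congr1 (fun w => w *m invmx (row_ebase J))).
rewrite mulmxK ?row_ebase_unit // mul0mx; move: h2.
rewrite pid_mx_col -[u]hsubmxK; move: (lsubmx u) (rsubmx u) => a b.
rewrite !mul_row_col !mulmx1 !mulmx0 add0r addr0 => -> ->.
by rewrite row_mx0.
Qed.

(** Injectivity of the differential is given at [a] alone; the Newton estimate spreads it to a
    ball. *)
Lemma inverse_function_ball n (A : set 'rV[R]_n) (f : 'rV[R]_n -> 'rV[R]_n) a :
  open A -> smooth_on A f -> A a -> (forall v, 'd f a v = 0 -> v = 0) ->
  exists r : R, [/\ 0 < r, ball a r `<=` A,
    (forall x v, ball a r x -> 'd f x v = 0 -> v = 0) &
    forall x y, ball a r x -> ball a r y -> f x = f y -> x = y].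
Proof.
move=> oA sf Aa da; have uJ := diff_inj_unit da.
have [|r [r0 rA hr]] := newton_diff_small (M := mulmxr (invmx ('J f a))) oA sf Aa.
  by move=> v /=; rewrite -jacobianE mulmxK.
have dr x v : ball a r x -> 'd f x v = 0 -> v = 0 by exact: (newton_diff_inj hr).
have [s [s0 sr inj]] := inverse_function_local_inj (ball_open a r)
  (smooth_subset rA sf) dr (ballxx a r0).
by exists s; split=> // [x /sr/rA//|x v /sr]; exact: dr.
Qed.

Lemma smooth_inverse_ex n (A : set 'rV[R]_n) (f : 'rV[R]_n -> 'rV[R]_n) :
  open A -> smooth_on A f ->
  (forall x v, A x -> 'd f x v = 0 -> v = 0) ->
  (forall x y, A x -> A y -> f x = f y -> x = y) ->
  exists g, [/\ (forall x, A x -> g (f x) = x), open (f @` A) &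
                smooth_on (f @` A) g].
Proof.
move=> oA sf df inj; pose g y := xget 0 [set x | A x /\ f x = y].
have gf x : A x -> g (f x) = x.
  move=> Ax; rewrite /g; case: xgetP => [y _ [Ay fyx]|/(_ x)[]//].
  by apply: inj.
exists g; split=> //; first exact: (inverse_function_open oA sf df).
exact: (inverse_function_smooth oA sf df gf).
Qed.

(** Completing [F] by the linear map [P] gives a local diffeomorphism [G], and [h] sends [y] to the
    [G]-preimage of (0, y). The coordinate on the zero set is thus the restriction of a linear map
    of the ambient space. *)
Lemma submersion_chart e m n (A : set 'rV[R]_n) (F : 'rV[R]_n -> 'rV[R]_e) a :
  n = (e + m)%N -> open A -> smooth_on A F -> A a ->
  (forall w, exists v, 'd F a v = w) ->
  exists (P : 'M[R]_(n, m)) (B : set 'rV[R]_n) (B' : set 'rV[R]_m)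
    (h : 'rV[R]_m -> 'rV[R]_n),
  [/\ [/\ open B, B a, B `<=` A & open B'], smooth_on B' h,
    (forall y, B' y -> [/\ B (h y), F (h y) = 0 & h y *m P = y]) &
    (forall x, B x -> F x = 0 -> B' (x *m P) /\ h (x *m P) = x)].
Proof.
move=> nE; subst n => oA sF Aa surj.
have fJ : row_full ('J F a).
  (* Row vectors are multiplied from the left, so the rows of the left inverse are preimages of the
     basis vectors. *)
  apply/row_fullP; exists (\matrix_i xget 0 [set v | 'd F a v = delta_mx 0 i]).
  apply/row_matrixP => i; rewrite row_mul jacobianE rowK row1.
  by case: xgetP => // h; have [v] := surj (delta_mx 0 i); move/h.
have [P hP] := row_full_complement fJ.
pose L1 : {linear 'rV[R]_e -> 'rV[R]_(e + m)} := mulmxr (row_mx 1%:M 0).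
pose L2 : {linear 'rV[R]_m -> 'rV[R]_(e + m)} := mulmxr (row_mx 0 1%:M).
pose LP : {linear 'rV[R]_(e + m) -> 'rV[R]_(e + m)} := mulmxr (P *m row_mx 0 1%:M).
have LE u w : L1 u + L2 w = row_mx u w.
  by rewrite /L1 /L2 /= !mul_mx_row !mulmx1 !mulmx0 add_row_mx addr0 add0r.
have LPE u : LP u = L2 (u *m P) by rewrite /= mulmxA.
pose G x := L1 (F x) + LP x.
have GE x : G x = row_mx (F x) (x *m P) by rewrite /G LPE LE.
have sG : smooth_on A G.
  move=> k; apply: CkD => //; first exact: (smooth_linear_comp L1 oA sF).
  exact: smooth_linear.
have dG v : 'd G a v = 0 -> v = 0.
  have dF : differentiable (fun x => L1 (F x)) a.
    exact: (smooth_diff (smooth_linear_comp L1 oA sF) Aa).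
  have dL : differentiable LP a.
    by apply: linear_differentiable; exact: continuous_linear_rV.
  have cLP : continuous LP by exact: continuous_linear_rV.
  have -> : 'd G a v = L1 ('d F a v) + LP v.
    transitivity ('d (fun x => L1 (F x)) a v + 'd LP a v).
      exact: (congr1 (@^~ v) (diffD dF dL)).
    congr (_ + _); first exact: (diff_linear_comp L1 v (smooth_diff sF Aa)).
    exact: (congr1 (@^~ v) (diff_lin a cLP)).
  rewrite LPE LE => E; have : row_mx ('d F a v) (v *m P) = row_mx 0 0.
    by rewrite E row_mx0.
  by move=> /eq_row_mx[dF0]; apply: hP; rewrite jacobianE.
have [r [r0 rA dr inj]] := inverse_function_ball oA sG Aa dG.
have ob : open (ball a r) by exact: ball_open.
have [g [gG oG sg]] := smooth_inverse_ex ob (smooth_subset rA sG) dr inj.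
pose B' := L2 @^-1` (G @` ball a r).
have oB' : open B'.
  by apply: open_comp => // y _; exact: continuous_linear_rV.
have L2E y : L2 y = row_mx 0 y by rewrite -LE linear0 add0r.
exists P, (ball a r), B', (g \o L2); split.
- by split=> //; exact: ballxx.
- apply: (smooth_comp (B := G @` ball a r)) => //; exact: smooth_linear.
- move=> y [x Bx Gx]; have -> : (g \o L2) y = x by rewrite /comp -Gx gG.
  by move: Gx; rewrite GE L2E => /eq_row_mx[].
- move=> x Bx Fx; have Gx : G x = L2 (x *m P) by rewrite GE L2E Fx.
  by split; [exists x|rewrite /comp -Gx gG].
Qed.

End ImplicitFunction.

(** * Charts of submanifolds *)

Section SetVal.
Context {T : topologicalType} {A : set T}.

Lemma set_val_mem (z : A) : A (set_val z).
Proof. by rewrite set_valE; exact: set_valP. Qed.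

Lemma set_val_inj : injective (set_val : A -> T).
Proof. by rewrite set_valE; exact: val_inj. Qed.

Lemma set_val_ex x : A x -> exists z : A, set_val z = x.
Proof. by move=> Ax; exists (SigSub (mem_set Ax)); rewrite set_valE. Qed.

Lemma set_val_continuous : continuous (set_val : A -> T).
Proof. exact: initial_continuous. Qed.

Lemma set_type_openP (W : set A) :
  open W <-> exists2 N : set T, open N & W = set_val @^-1` N.
Proof. by split=> [[N oN <-]|[N oN ->]]; [exists N|exists N]. Qed.

End SetVal.

Lemma open_preimage_within (S T : topologicalType) (A : set S) (f : S -> T)
    (B : set T) :
  open A -> {within A, continuous f} -> open B -> open (A `&` f @^-1` B).
Proof.
move=> oA cf oB; have [h _] := @continuous_inP S T A f oA.
by apply: h => //; rewrite -continuous_open_subspace.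
Qed.

Section Charts.
Context {R : realType}.

Lemma left_inverse_diff_inj (V W : normedModType R) (f : V -> W) (g : W -> V) x v :
  (\forall y \near x, g (f y) = y) ->
  differentiable f x -> differentiable g (f x) -> 'd f x v = 0 -> v = 0.
Proof.
move=> gf df dg h; have [_ E] := near_eq_diff gf (differentiable_comp df dg).
have Eid : 'd id x = id :> (V -> V) by exact: diff_val.
have E2 := congr1 (@^~ v) (diff_comp df dg).
rewrite -[v]/(id v) -(congr1 (@^~ v) Eid) (congr1 (@^~ v) E).
by apply: etrans E2 _; rewrite /= h linear0.
Qed.

Section Chart.
Context {M : topologicalType} {n : nat} (c : chart R M n).

Lemma cinvK x : (c @` cdom c) x -> cdom c (cinv c x) /\ c (cinv c x) = x.
Proof. by move=> [u cu <-]; rewrite cmapK ?inE. Qed.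

Lemma chartK u : cdom c u -> cinv c (c u) = u.
Proof. by move=> cu; rewrite cmapK ?inE. Qed.

Lemma chart_open_preimage (A : set 'rV[R]_n) : open A ->
  open (cdom c `&` c @^-1` A).
Proof.
exact: (@open_preimage_within _ _ _ c _ (cdom_open c) (@cmap_continuous _ _ _ c)).
Qed.

Lemma chart_open_image (W : set M) : open W -> W `<=` cdom c -> open (c @` W).
Proof.
move=> oW Wc; rewrite (_ : _ @` _ = c @` cdom c `&` cinv c @^-1` W).
  exact: (@open_preimage_within _ _ _ (cinv c) _ (@cimg_open _ _ _ c)
    (@cinv_continuous _ _ _ c) oW).
apply/seteqP; split=> [_ [u Wu <-]|x [/cinvK[cx xE] Wx]].
  by split; [exists u => //; exact: Wc|rewrite /= chartK //; exact: Wc].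
by exists (cinv c x).
Qed.

Lemma chart_continuous u : cdom c u -> {for u, continuous c}.
Proof.
have := @cmap_continuous _ _ _ c; rewrite continuous_open_subspace; last exact: cdom_open.
by move=> h cu; apply: h; rewrite inE.
Qed.

Lemma cinv_continuous_at x : (c @` cdom c) x -> {for x, continuous (cinv c)}.
Proof.
have := @cinv_continuous _ _ _ c; rewrite continuous_open_subspace; last exact: cimg_open.
by move=> h cu; apply: h; rewrite inE.
Qed.

End Chart.

Definition smooth_fun (M : topologicalType) (d : int) (S : smooth_structure R M d)
    m (D : set M) (q : M -> 'rV[R]_m) : Prop :=
  forall c, charts S c -> smooth_on (c @` (D `&` cdom c)) (q \o cinv c).

Section Submanifold.
Context {M : topologicalType} {d : int} (S : smooth_structure R M d).
Variable Z : set M.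

(* Stated through the ambient manifold, so that the transition map between two
   such charts factors as an inclusion followed by a smooth ambient map. *)
Definition sub_chart m (k : chart R (set_type Z) m) : Prop :=
  (forall c, charts S c ->
     smooth_on (k @` (cdom k `&` set_val @^-1` cdom c)) (c \o set_val \o cinv k)) /\
  exists (D : set M) (q : M -> 'rV[R]_m),
    [/\ open D, smooth_fun S D q &
      forall z, cdom k z -> D (set_val z) /\ q (set_val z) = k z].

Lemma open_val_cdom m (k : chart R (set_type Z) m) (c : chart R M `|d|) :
  open (cdom k `&` set_val @^-1` cdom c).
Proof.
apply: openI; first exact: cdom_open.
apply: open_comp; last exact: cdom_open.
by move=> z _; exact: set_val_continuous.
Qed.

(** The ambient extension [q] of the coordinate map is a smooth local left inverse of the
    inclusion. *)
Lemma sub_chart_immersion m (k : chart R (set_type Z) m) c z v :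
  sub_chart k -> charts S c -> cdom k z -> cdom c (set_val z) ->
  'd (c \o set_val \o cinv k) (k z) v = 0 -> v = 0.
Proof.
move=> [ks [D [q [oD qs qk]]]] Sc kz cz h.
have [Dz qz] := qk z kz.
pose f := c \o set_val \o cinv k.
have dz : differentiable f (k z) by apply: (smooth_diff (ks c Sc)); exists z.
have fz : f (k z) = c (set_val z) by rewrite /f /= chartK.
have dq : differentiable (q \o cinv c) (f (k z)).
  by rewrite fz; apply: (smooth_diff (qs c Sc)); exists (set_val z).
have oW : open (k @` (cdom k `&` set_val @^-1` cdom c)).
  by apply: chart_open_image; [exact: open_val_cdom|exact: subIsetl].
apply: (left_inverse_diff_inj _ dz dq h).
have Wz : (k @` (cdom k `&` set_val @^-1` cdom c)) (k z) by exists z.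
apply: filterS (open_nbhs_nbhs (conj oW Wz)) => _ [u [ku cu] <-].
by rewrite /f /= !chartK //; have [] := qk u ku.
Qed.

End Submanifold.

End Charts.

(** * Maps between submanifolds read in their charts *)

Section Transition.
Context {R : realType}.

Lemma near_eq_diff_comp (V W1 W2 V' : normedModType R) (f1 : V -> W1)
    (g1 : W1 -> V') (f2 : V -> W2) (g2 : W2 -> V') x v :
  (\forall y \near x, g1 (f1 y) = g2 (f2 y)) ->
  differentiable f1 x -> differentiable g1 (f1 x) ->
  differentiable f2 x -> differentiable g2 (f2 x) ->
  'd g1 (f1 x) ('d f1 x v) = 'd g2 (f2 x) ('d f2 x v).
Proof.
move=> e df1 dg1 df2 dg2.
have [_ E] := near_eq_diff e (differentiable_comp df1 dg1).
have E1 := congr1 (@^~ v) (diff_comp df1 dg1).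
have E2 := congr1 (@^~ v) (diff_comp df2 dg2).
exact: etrans (esym E1) (etrans (esym (congr1 (@^~ v) E)) E2).
Qed.

Context {M M' : topologicalType} {d d' : int}.
Variables (S : smooth_structure R M d) (S' : smooth_structure R M' d').
Variables (D : set M) (phi : M -> M').
Hypothesis oD : open D.
Hypothesis phi_smooth : smooth_map S S' D phi.
Variables (Z : set M) (Z' : set M') (m : nat).
Variables (k : chart R (set_type Z) m) (k' : chart R (set_type Z') m).
Hypothesis sk : sub_chart S k.
Hypothesis sk' : sub_chart S' k'.
Variable W : set (set_type Z).
Hypothesis oW : open W.
Hypothesis Wk : W `<=` cdom k.
Hypothesis WD : forall z, W z -> D (set_val z).
Hypothesis Wk' : forall z, W z ->
  exists z', cdom k' z' /\ phi (set_val z) = set_val z'.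
Variable T : 'rV[R]_m -> 'rV[R]_m.
Hypothesis TE : forall z z', W z -> cdom k' z' -> phi (set_val z) = set_val z' ->
  T (k z) = k' z'.

Let open_pre (B : set M') : open B -> open (D `&` phi @^-1` B).
Proof. by case: phi_smooth => h _; exact: open_preimage_within. Qed.

(** Shrinks [W] until the ambient expression of [phi] is defined; [B] is the domain of a target
    chart, possibly cut down to that of the extension [q]. *)
Let cut (c : chart R M `|d|) (B : set M') :=
  W `&` set_val @^-1` (cdom c `&` (D `&` phi @^-1` B)).

Let cut_open c B : open B -> open (cut c B).
Proof.
move=> oB; apply: openI => //; apply: open_comp.
  by move=> z _; exact: set_val_continuous.
by apply: openI; [exact: cdom_open|exact: open_pre].
Qed.

Let cut_image_open c B : open B -> open (k @` cut c B).
Proof.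
move=> oB; apply: chart_open_image; first exact: cut_open.
by move=> z [/Wk].
Qed.

(** Locally [T] is a composite of three smooth maps: the inclusion read in [k] and [c], then [phi]
    read in [c] and [c'], then the extension [q] of [k'] read in [c']. *)
Lemma transition_smooth : smooth_on (k @` W) T.
Proof.
case: (sk) => ks _; case: (sk') => _ [D' [q [oD' qs qk]]].
apply: smooth_local => _ [z Wz <-].
have [c Sc cz] := charts_cover S (set_val z).
have [c' Sc' cz'] := charts_cover S' (phi (set_val z)).
have [z' [kz' zz']] := Wk' Wz.
pose B := cdom c' `&` D'.
have oB : open B by apply: openI => //; exact: cdom_open.
have Bz : cut c B z.
  split=> //; split=> //; split; first exact: WD.
  by split=> //; rewrite zz'; have [] := qk _ kz'.
exists (k @` cut c B); first by exists z.
pose B1 := c @` (D `&` cdom c `&` phi @^-1` B).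
have oB1 : open B1.
  apply: chart_open_image; last by move=> ? [[]].
  rewrite setIAC; apply: openI; [exact: open_pre|exact: cdom_open].
have oB2 : open (c' @` (D' `&` cdom c')).
  by apply: chart_open_image; [apply: openI => //; exact: cdom_open|exact: subIsetr].
have s1 : smooth_on (k @` cut c B) (c \o set_val \o cinv k).
  apply: smooth_subset (ks c Sc) => _ [u [/Wk ku [cu _]] <-].
  by exists u.
have s2 : smooth_on B1 (c' \o phi \o cinv c).
  case: phi_smooth => _ h; apply: smooth_subset (h c c' Sc Sc').
  by move=> _ [u [[Du cu] [c'u _]] <-]; exists u.
have s12 : smooth_on (k @` cut c B) ((c' \o phi \o cinv c) \o (c \o set_val \o cinv k)).
  apply: smooth_comp s1 s2 => //; first exact: cut_image_open.
  move=> _ [u [/Wk ku [cu [Du Bu]]] <-] /=.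
  by rewrite chartK //; exists (set_val u).
have s3 := smooth_comp (cut_image_open oB) oB2 _ s12 (qs c' Sc').
apply: smooth_eq (s3 _); first exact: cut_image_open.
  move=> _ [u [Wu [cu [Du [c'u D'u]]]] <-] /=.
  have ku := Wk Wu; rewrite !chartK //.
  have [u' [ku' uu']] := Wk' Wu.
  by rewrite uu' (TE Wu ku' uu'); have [] := qk _ ku'.
move=> _ [u [Wu [cu [Du [c'u D'u]]]] <-] /=.
have ku := Wk Wu; rewrite !chartK //.
by exists (phi (set_val u)).
Qed.

Hypothesis phi_immersion : forall u c c', D u -> charts S c -> charts S' c' ->
  cdom c u -> cdom c' (phi u) -> lker (dmap c c' phi u) = 0%VS.

(** In [f2 (f1 y) = f3 (T y)] the differentials of [f1] and [f2] are injective, so that of [T] is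
    too. *)
Lemma transition_immersion y v : (k @` W) y -> 'd T y v = 0 -> v = 0.
Proof.
case: (sk) => ks _; case: (sk') => ks' _.
move=> [z Wz <-] h.
have [c Sc cz] := charts_cover S (set_val z).
have [c' Sc' cz'] := charts_cover S' (phi (set_val z)).
have [z' [kz' zz']] := Wk' Wz.
have kz := Wk Wz; have Tz := TE Wz kz' zz'.
have oB : open (cdom c') by exact: cdom_open.
pose f1 := c \o set_val \o cinv k; pose f2 := c' \o phi \o cinv c.
pose f3 := c' \o set_val \o cinv k'.
have df1 : differentiable f1 (k z) by apply: (smooth_diff (ks c Sc)); exists z.
have f1z : f1 (k z) = c (set_val z) by rewrite /f1 /= chartK.
have df2 : differentiable f2 (f1 (k z)).
  rewrite f1z; case: phi_smooth => _ hs; apply: (smooth_diff (hs c c' Sc Sc')).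
  by exists (set_val z) => //; split=> //; split=> //; exact: WD.
have dT : differentiable T (k z).
  by apply: (smooth_diff transition_smooth); exists z.
have df3 : differentiable f3 (T (k z)).
  rewrite Tz; apply: (smooth_diff (ks' c' Sc')).
  by exists z' => //; split=> //; rewrite /preimage /= -zz'.
have E : \forall y \near k z, f2 (f1 y) = f3 (T y).
  have Cz : cut c (cdom c') z by split=> //; split=> //; split=> //; exact: WD.
  have Bz : (k @` cut c (cdom c')) (k z) by exists z.
  apply: filterS (open_nbhs_nbhs (conj (cut_image_open oB) Bz)).
  move=> _ [u [Wu [cu [Du c'u]]] <-]; have [u' [ku' uu']] := Wk' Wu.
  have ku := Wk Wu.
  by rewrite (TE Wu ku' uu') /f1 /f2 /f3 /= !chartK // uu'.
have := near_eq_diff_comp v E df1 df2 dT df3.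
rewrite h linear0 => h2.
apply: (sub_chart_immersion sk Sc kz cz).
have : lker (dmap c c' phi (set_val z)) == 0%VS.
  by apply/eqP; apply: phi_immersion => //; exact: WD.
move=> /lker0P; apply; rewrite /dmap !lfunE /= -/f2 linear0.
by rewrite -f1z.
Qed.

Lemma transition_open : open (T @` (k @` W)).
Proof.
have oI : open (k @` W) by exact: chart_open_image.
exact: (inverse_function_open oI transition_smooth transition_immersion).
Qed.

Lemma transition_inverse_smooth (T' : 'rV[R]_m -> 'rV[R]_m) :
  (forall z z', W z -> cdom k' z' -> phi (set_val z) = set_val z' ->
     T' (k' z') = k z) ->
  smooth_on (T @` (k @` W)) T'.
Proof.
move=> T'E; have oI : open (k @` W) by exact: chart_open_image.
apply: (inverse_function_smooth oI transition_smooth transition_immersion).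
move=> _ [z Wz <-]; have [z' [kz' zz']] := Wk' Wz.
by rewrite (TE Wz kz' zz') (T'E _ _ Wz kz' zz').
Qed.

End Transition.

(** * Zero sets as submanifolds *)

Section SubStructure.
Context {R : realType}.

Lemma set_type_continuous_at (S T : topologicalType) (A : set T) (f : S -> A) x :
  {for x, continuous (set_val \o f)} -> {for x, continuous f}.
Proof.
move=> cf N; rewrite nbhsE => -[W [/set_type_openP[N' oN' ->] Wx] WN].
have := cf N' (open_nbhs_nbhs (conj oN' Wx)).
by rewrite /nbhs /=; apply: filterS => y; exact: WN.
Qed.

Lemma near_eq_continuous (S T : topologicalType) (f g : S -> T) x :
  (\forall y \near x, f y = g y) -> {for x, continuous f} -> {for x, continuous g}.
Proof.
move=> fg; rewrite /prop_for /continuous_at -(nbhs_singleton fg).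
by apply: cvg_trans; exact: near_eq_cvg.
Qed.

Lemma vcoord_inj (E : vectType R) : injective (@vcoord R E).
Proof. exact: (can_inj (rVofK (vbasisP _))). Qed.

Lemma vcoord0 (E : vectType R) : vcoord (0 : E) = 0.
Proof. exact: linear0. Qed.

Context {M : topologicalType} {d : int} (S : smooth_structure R M d).

Lemma smooth_fun_continuous m (D : set M) (q : M -> 'rV[R]_m) x :
  open D -> smooth_fun S D q -> D x -> {for x, continuous q}.
Proof.
move=> oD sq Dx; have [c Sc cx] := charts_cover S x.
have oW : open (D `&` cdom c) by apply: openI => //; exact: cdom_open.
have Wx : (c @` (D `&` cdom c)) (c x) by exists x.
have cq := smooth_continuous (sq c Sc) Wx.
have cqc : {for x, continuous (q \o cinv c \o c)}.
  by apply: continuous_comp => //; exact: chart_continuous.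
apply: near_eq_continuous cqc.
apply: filterS (open_nbhs_nbhs (conj oW (conj Dx cx))) => y [Dy cy] /=.
by rewrite chartK.
Qed.

Lemma id_smooth_map : smooth_map S S setT id.
Proof.
split=> [|c c' Sc Sc']; first by apply: continuous_subspaceT => x; exact: cvg_id.
by rewrite setTI; exact: (charts_compat Sc Sc').
Qed.

Section ZeroSet.
Context (E : vectType R) (V : set M) (F : M -> E).
Hypothesis oV : open V.
Hypothesis sF : smooth_vmap S V F.

Let Z := [set x | V x /\ F x = 0].

Lemma dvmap_surj (c : chart R M `|d|) u :
  limg (dvmap c F u) = fullv ->
  forall w, exists v, 'd (@vcoord R E \o F \o cinv c) (c u) v = w.
Proof.
move=> h w; pose L : {linear 'rV[R]_(`|d|) -> E} :=
  vecof (vbasis {:E}) \o 'd (@vcoord R E \o F \o cinv c) (c u).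
have : vecof (vbasis {:E}) w \in limg (dvmap c F u) by rewrite h memvf.
case/memv_imgP => v _; rewrite (lfunE L) /L /= => e; exists v.
by apply: (can_inj (vecofK (vbasisP _))).
Qed.

(** The coordinate is [Q], the ambient chart followed by the linear map [P] of [submersion_chart].
    Being defined on all of [cdom c], it also serves as the ambient extension required by
    [sub_chart]. *)
Lemma zero_set_chart m (z : set_type Z) (c : chart R M `|d|) :
  (`|d| = \dim {:E} + m)%N -> charts S c -> cdom c (set_val z) ->
  limg (dvmap c F (set_val z)) = fullv ->
  exists k : chart R (set_type Z) m, sub_chart S k /\ cdom k z.
Proof.
move=> dE Sc cz surj; pose A := c @` (V `&` cdom c).
have oVc : open (V `&` cdom c) by apply: openI => //; exact: cdom_open.
have oA : open A by apply: chart_open_image => //; exact: subIsetr.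
have Az : A (c (set_val z)).
  by exists (set_val z) => //; split=> //; case: (set_val_mem z).
have [P [B [B' [h [[oB Bz BA oB'] sh h1 h2]]]]] :=
  submersion_chart dE oA (sF Sc) Az (dvmap_surj surj).
pose LP : {linear 'rV[R]_(`|d|) -> 'rV[R]_m} := mulmxr P.
pose Q x := LP (c x).
have Zx y : B' y -> Z (cinv c (h y)).
  move=> /h1[Bh Fh _]; have [u [Vu cu] uE] := BA _ Bh.
  rewrite -uE chartK //; split=> //; apply: vcoord_inj; rewrite vcoord0.
  by move: Fh; rewrite -uE /= chartK.
(* The inverse chart must be total; off [B'] the choice may fall back to [z]. *)
pose lift y : set_type Z := xget z [set u | set_val u = cinv c (h y)].
have liftE y : B' y -> set_val (lift y) = cinv c (h y).
  move=> /Zx/set_val_ex[u uE]; rewrite /lift.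
  by case: xgetP => [v _ //|/(_ u)]; rewrite /= uE.
pose k0 := [set u : set_type Z | cdom c (set_val u) /\ B (c (set_val u))].
have ok0 : open k0.
  apply/set_type_openP; exists (cdom c `&` c @^-1` B) => //.
  exact: chart_open_preimage.
have cB x : B x -> cdom c (cinv c x) /\ c (cinv c x) = x.
  by move=> /BA[u [Vu cu] <-]; rewrite chartK.
have k0B' u : k0 u -> B' (Q (set_val u)) /\ h (Q (set_val u)) = c (set_val u).
  move=> [cu Bu]; apply: h2 => //=; rewrite chartK //.
  by have [_ ->] := set_val_mem u; exact: vcoord0.
have liftk0 y : B' y -> k0 (lift y) /\ Q (set_val (lift y)) = y.
  move=> B'y; have [Bh _ hP] := h1 y B'y; have [ch cinvh] := cB _ Bh.
  by rewrite /k0 /Q /= liftE // cinvh.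
have imk : (fun u => Q (set_val u)) @` k0 = B'.
  apply/seteqP; split=> [_ [u /k0B'[] + _ <-]//|y B'y].
  by exists (lift y); have [] := liftk0 y B'y.
have kK : {in k0, cancel (fun u => Q (set_val u)) lift}.
  move=> u; rewrite inE => ku; have [B'u hu] := k0B' u ku.
  by apply: set_val_inj; rewrite liftE // hu chartK //; case: ku.
have ck : {within k0, continuous (fun u : set_type Z => Q (set_val u))}.
  rewrite continuous_open_subspace // => u; rewrite inE => -[cu _].
  apply: (@continuous_comp _ _ _ set_val Q); first exact: set_val_continuous.
  apply: (@continuous_comp _ _ _ c LP); first exact: chart_continuous.
  exact: continuous_linear_rV.
have clift : {within (fun u => Q (set_val u)) @` k0, continuous lift}.
  rewrite imk continuous_open_subspace // => y; rewrite inE => B'y.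
  apply: set_type_continuous_at.
  have chy : {for y, continuous (cinv c \o h)}.
    apply: continuous_comp; first exact: smooth_continuous sh B'y.
    apply: cinv_continuous_at; have [Bh _ _] := h1 y B'y.
    by have [u [Vu cu] <-] := BA _ Bh; exists u.
  apply: near_eq_continuous chy.
  by apply: filterS (open_nbhs_nbhs (conj oB' B'y)) => t /liftE /= ->.
have oim : open ((fun u => Q (set_val u)) @` k0) by rewrite imk.
pose k := Chart ok0 oim ck clift kK.
exists k; split; last by split=> //; exact: Bz.
split=> [c' Sc'|].
  have oD : open (k @` (cdom k `&` set_val @^-1` cdom c')).
    by apply: chart_open_image; [exact: open_val_cdom|exact: subIsetl].
  have oC : open (c @` (cdom c `&` cdom c')).
    apply: chart_open_image; last exact: subIsetl.
    by apply: openI; exact: cdom_open.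
  have sub : k @` (cdom k `&` set_val @^-1` cdom c') `<=` B'.
    by move=> _ [u [/k0B'[]]] + _ _ <-.
  have CC := charts_compat Sc Sc'.
  apply: smooth_eq (smooth_comp oD oC _ (smooth_subset sub sh) CC) => //.
    by move=> y /sub B'y /=; rewrite liftE.
  move=> _ [u [ku c'u] <-]; have [_ hu] := k0B' u ku.
  by exists (set_val u); [split=> //; case: ku|rewrite -hu].
exists (cdom c), Q; split; [exact: cdom_open| |by move=> u [cu _]].
move=> c' Sc'; apply: (smooth_linear_comp LP).
  apply: chart_open_image; last exact: subIsetr.
  by apply: openI; exact: cdom_open.
by rewrite setIC; exact: (charts_compat Sc' Sc).
Qed.

End ZeroSet.
End SubStructure.

Section SubManifold.
Context {R : realType} {M : topologicalType} {d : int}.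
Variables (S : smooth_structure R M d) (Z : set M) (d' : int).
Hypothesis Z_cover : forall z : set_type Z,
  exists k : chart R (set_type Z) `|d'|, sub_chart S k /\ cdom k z.
Hypothesis Z_dim : set_type Z -> 0 <= d'.

Let sub_charts := [set k : chart R (set_type Z) `|d'| | sub_chart S k].

Let sub_charts_cover z : exists2 k, sub_charts k & cdom k z.
Proof. by have [k [sk kz]] := Z_cover z; exists k. Qed.

Let sub_charts_compat k k' : sub_charts k -> sub_charts k' ->
  smooth_on (k @` (cdom k `&` cdom k')) (k' \o cinv k).
Proof.
move=> sk sk'; apply: (transition_smooth openT (id_smooth_map S) sk sk') => //.
- by apply: openI; exact: cdom_open.
- by move=> z [_ kz']; exists z.
- by move=> z z' [kz _] kz' /set_val_inj <-; rewrite /= chartK.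
Qed.

Definition sub_structure : smooth_structure R (set_type Z) d' :=
  SmoothStructure sub_charts_cover sub_charts_compat Z_dim.

Lemma sub_structure_embedding : smooth_embedding sub_structure S setT set_val.
Proof.
split.
- split; first by apply: continuous_subspaceT; exact: set_val_continuous.
  by move=> k c [ks _] Sc; rewrite setTI; exact: ks.
- move=> z k c _ sk Sc kz cz; apply/eqP/lker0P => u v.
  rewrite /dmap !lfunE /= => uv; apply/eqP; rewrite -subr_eq0; apply/eqP.
  apply: (sub_chart_immersion sk Sc kz cz).
  by rewrite linearB /= uv subrr.
- split.
  + split=> [z _|z z' _ _|_ [z _ <-]]; [by exists z|exact: set_val_inj|by exists z].
  + by apply: continuous_subspaceT; exact: set_val_continuous.
  + move=> g gK; apply/subspace_continuousP => _ [z _ <-].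
    have gv u : g (set_val u) = u by apply: gK; rewrite inE.
    move=> N; rewrite /from_subspace gv nbhsE.
    move=> [W [/set_type_openP[N' oN' ->] Wz] WN].
    apply: filterS (open_nbhs_nbhs (conj oN' Wz)) => x N'x [u _ ux].
    by apply: WN; rewrite /preimage /= -ux gv ux.
Qed.

End SubManifold.

(** * Tame atlases *)

Lemma qproj_eqP (T : topologicalType) (r : T -> T -> Prop) (x y : T) :
  qproj r x = qproj r y <-> clos_refl_sym_trans T r x y.
Proof.
split=> [/eqmodP/asboolP//|h]; first exact/eqmodP/asboolP.
Qed.

Lemma qproj_surj (T : topologicalType) (r : T -> T -> Prop)
  (z : quotient_space r) : exists x, qproj r x = z.
Proof. by exists (repr (z : {eq_quot gen_equiv r}%qT)); exact: reprK. Qed.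

Lemma qproj_openP (T : topologicalType) (r : T -> T -> Prop)
  (A : set (quotient_space r)) : open A <-> open (qproj r @^-1` A).
Proof. by []. Qed.

Section TameAtlas.
Context {R : realType} {X : topologicalType} {d : int}.
Variable K : kuranishi_atlas R X d.
Hypothesis K_tame : tame K.

Local Notation idx := (kidx (kF K)).
Local Notation U I := (kU (katlas_chart K I)).
Local Notation E I := (kE (katlas_chart K I)).
Local Notation UU I J := (Defs.codom (kcoord K I J)).
Local Notation phi I J := (cophi (kcoord K I J)).
Local Notation hat I J := (cohat (kcoord K I J)).
Local Notation SU I := (kS (katlas_chart K I)).
Implicit Types I J L : idx.

Lemma idx_sub_cases I J : val I \subset val J -> I = J \/ val I \proper val J.
Proof.
rewrite finset.subEproper => /orP[/eqP/val_inj ->|]; [by left|by right].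
Qed.

Lemma codom_self I x : UU I I x.
Proof. by rewrite kcodom_id. Qed.

Lemma cophi_id I : phi I I = id.
Proof. by apply/funext => x; exact: kcophi_id. Qed.

Lemma codom_open I J : val I \subset val J -> open (UU I J).
Proof.
case/idx_sub_cases => [->|IJ]; first by rewrite kcodom_id; exact: openT.
exact: co_open (coordP IJ).
Qed.

Lemma cophi_embedding I J : val I \subset val J ->
  smooth_embedding (SU I) (SU J) (UU I J) (phi I J).
Proof.
case/idx_sub_cases => [<-|IJ]; last exact: co_emb (coordP IJ).
rewrite kcodom_id cophi_id; split; first exact: id_smooth_map.
- move=> u c c' _ Sc Sc' cu c'u; apply/eqP/lker0P => v w.
  rewrite /dmap !lfunE /= => vw; apply/eqP; rewrite -subr_eq0; apply/eqP.
  have Wu : (c @` (cdom c `&` cdom c')) (c u) by exists u.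
  have oW : open (c @` (cdom c `&` cdom c')).
    by apply: chart_open_image; [apply: openI; exact: cdom_open|exact: subIsetl].
  apply: (@left_inverse_diff_inj _ _ _ (c' \o id \o cinv c) (c \o cinv c') (c u)).
  + apply: filterS (open_nbhs_nbhs (conj oW Wu)) => _ [t [ct c't] <-] /=.
    by rewrite !chartK.
  + exact: (smooth_diff (charts_compat Sc Sc')).
  + rewrite /= chartK //; apply: (smooth_diff (charts_compat Sc' Sc)).
    by exists u.
  + by rewrite linearB /= vw subrr.
- split.
  + by split=> [z _|z z' _ _|z _]; [exists z| |exists z => //; move: z => z []].
  + by apply: continuous_subspaceT => x; exact: cvg_id.
  + move=> g gK; apply: continuous_subspaceT => x.
    rewrite (_ : g = id); first exact: cvg_id.
    by apply/funext => y; apply: gK; rewrite inE.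
Qed.

Lemma cophi_inj I J x y : val I \subset val J -> UU I J x -> UU I J y ->
  phi I J x = phi I J y -> x = y.
Proof.
move=> /cophi_embedding[_ _ [[_ inj _] _ _]] Ux Uy e.
by apply: inj => //; rewrite inE.
Qed.

Lemma cophi_section I J x : val I \subset val J -> UU I J x ->
  ks (phi I J x) = hat I J (ks x).
Proof.
case/idx_sub_cases => [<-|IJ]; first by rewrite cophi_id kcohat_id.
by move=> Ux; exact: (co_section (coordP IJ)).
Qed.

Lemma cohat_inj I J : val I \subset val J -> injective (hat I J).
Proof.
case/idx_sub_cases => [<-|IJ]; last exact: co_inj (coordP IJ).
by move=> x y; rewrite !kcohat_id.
Qed.

Lemma cohat_cocycle I J L e : val I \subset val J -> val J \subset val L ->
  hat J L (hat I J e) = hat I L e.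
Proof.
move=> /idx_sub_cases[<-|IJ]; first by rewrite kcohat_id.
move=> /idx_sub_cases[<-|JL]; first by rewrite kcohat_id.
exact: cocycle_hat.
Qed.

Lemma cophi_cocycle I J L x : val I \subset val J -> val J \subset val L ->
  UU I J x -> UU J L (phi I J x) ->
  UU I L x /\ phi J L (phi I J x) = phi I L x.
Proof.
move=> /idx_sub_cases[<-|IJ]; first by rewrite cophi_id.
move=> /idx_sub_cases[<-|JL]; first by rewrite cophi_id.
by move=> Ux Upx; split; [exact: (cocycle_dom IJ JL)|exact: cocycle_phi].
Qed.

(** Here J ∪ L = L, so the intersection axiom reads U_IJ ∩ U_IL = U_IL. *)
Lemma codom_sub I J L x : val I \subset val J -> val J \subset val L ->
  UU I L x -> UU I J x.
Proof.
move=> IJ JL Ux; have IL := fintype.subset_trans IJ JL.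
have [_ t _] := K_tame; have := t I J L IJ IL.
rewrite (finset.setUidPr JL) => /(congr1 (fun A => A x)) /= e.
have : kdom (I := I) (val L) x by exists L.
by rewrite -e => -[].
Qed.

Lemma codom_join I J L x : val I \subset val J -> val I \subset val L ->
  UU I J x -> UU I L x ->
  exists J', [/\ val J' = (val J :|: val L)%SET & UU I J' x].
Proof.
move=> IJ IL UJ UL; have [_ t _] := K_tame.
have : kdom (I := I) (val J :|: val L)%SET x by rewrite -t.
by case=> J' e UJ'; exists J'.
Qed.

Lemma cophi_lift I J L y e : val I \subset val J -> val J \subset val L ->
  UU J L y -> ks y = hat I J e -> exists2 x, UU I L x & phi I J x = y.
Proof.
move=> IJ JL Uy ye; have [_ _ t] := K_tame.
by have : (phi I J @` UU I L) y by rewrite t //; split=> //; exists e.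
Qed.

Lemma cophi_dom I J L x : val I \subset val J -> val J \subset val L ->
  UU I L x -> UU J L (phi I J x) /\ phi J L (phi I J x) = phi I L x.
Proof.
move=> IJ JL Ux; have [_ _ t] := K_tame.
have : (phi I J @` UU I L) (phi I J x) by exists x.
rewrite t // => -[UJL _]; split=> //.
by have [] := cophi_cocycle IJ JL (codom_sub IJ JL Ux) UJL.
Qed.

(* Tameness makes this relation transitive, so it is the whole equivalence
   relation generated by the coordinate changes. *)
Definition agree (w w' : ksum K) : Prop := exists L,
  [/\ val (projT1 w) \subset val L, val (projT1 w') \subset val L,
      UU (projT1 w) L (projT2 w), UU (projT1 w') L (projT2 w') &
      phi (projT1 w) L (projT2 w) = phi (projT1 w') L (projT2 w')].

(** The middle point lies in U_JL and in U_JL', hence by tameness in U_JQ with Q = L ∪ L', which is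
    therefore an index. Both agreements are pushed forward to U_Q. *)
Lemma agree_trans w1 w2 w3 : agree w1 w2 -> agree w2 w3 -> agree w1 w3.
Proof.
case: w1 w2 w3 => [I x] [J y] [N z] [L [/= IL JL Ux Uy xy]] [L' [/= JL' NL' Uy' Uz yz]].
have [Q [QE UQ]] := codom_join JL JL' Uy Uy'.
have LQ : val L \subset val Q by rewrite QE finset.subsetUl.
have LQ' : val L' \subset val Q by rewrite QE finset.subsetUr.
have [UL yL] := cophi_dom JL LQ UQ; have [UL' yL'] := cophi_dom JL' LQ' UQ.
rewrite -xy in UL yL; rewrite yz in UL' yL'.
have [UxQ xQ] := cophi_cocycle IL LQ Ux UL.
have [UzQ zQ] := cophi_cocycle NL' LQ' Uz UL'.
exists Q; split=> //=.
- exact: fintype.subset_trans IL LQ.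
- exact: fintype.subset_trans NL' LQ'.
- by rewrite -xQ -zQ yL yL'.
Qed.

Lemma kproj_eqP (w w' : ksum K) : kproj w = kproj w' <-> agree w w'.
Proof.
split=> [/qproj_eqP|].
  elim=> {w w'} [_ _ [I J x IJ Ux]|w|w w' _ [L [*]]|w1 w2 w3 _ h _].
  - have sIJ := fintype.proper_sub IJ.
    by exists J; split=> //=; rewrite ?cophi_id //; exact: codom_self.
  - exists (projT1 w); split=> //; exact: codom_self.
  - by exists L; split.
  - exact: agree_trans h.
case: w w' => [I x] [J y] [L [/= IL JL Ux Uy xy]].
have step (N : idx) (z : U N) : val N \subset val L -> UU N L z ->
    kproj (K := K) (existT _ N z) = kproj (existT _ L (phi N L z)).
  case/idx_sub_cases => [<-|NL] Uz; first by rewrite cophi_id.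
  by apply/qproj_eqP; apply: rst_step; exact: KStep.
by rewrite (step I) // (step J) // xy.
Qed.

(** Comparing sections in E_L shows that s_J(y) lies in the image of E_I. Tameness lifts [y] to U_I,
    and injectivity of φ_IL identifies the lift with [x]. *)
Lemma agree_sub I J (x : U I) (y : U J) : val I \subset val J ->
  kproj (K := K) (existT _ I x) = kproj (existT _ J y) ->
  UU I J x /\ phi I J x = y.
Proof.
move=> IJ /kproj_eqP[L [/= IL JL Ux Uy xy]].
have : ks (phi J L y) = hat I L (ks x) by rewrite -xy cophi_section.
rewrite cophi_section // -(cohat_cocycle _ IJ JL) => /(cohat_inj JL) ksy.
have [x' Ux' x'y] := cophi_lift IJ JL Uy ksy.
have xx' : x' = x.
  apply: (cophi_inj IL) => //; have [_ <-] := cophi_dom IJ JL Ux'.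
  by rewrite x'y -xy.
by rewrite -xx'; split=> //; exact: codom_sub IJ JL Ux'.
Qed.

Lemma agree_cophi I J (x : U I) : val I \subset val J -> UU I J x ->
  kproj (K := K) (existT _ I x) = kproj (existT _ J (phi I J x)).
Proof.
move=> IJ Ux; apply/kproj_eqP; exists J; split=> //=; first exact: codom_self.
by rewrite cophi_id.
Qed.

End TameAtlas.

(** * Closed relations and compact sets *)

Section ClosedRelations.

Lemma closed_within_eq (S T H : topologicalType) (A : set S) (B : set T)
    (g : S -> H) (h : T -> H) :
  hausdorff_space H -> closed A -> closed B ->
  {within A, continuous g} -> {within B, continuous h} ->
  closed [set p : S * T | [/\ A p.1, B p.2 & g p.1 = h p.2]].
Proof.
move=> hH cA cB /subspace_continuousP cg /subspace_continuousP ch [x y] clxy.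
have Ax : A x.
  apply: cA => N Nx; have [|[x' y'] [[Ax' _ _] [/= Nx' _]]] := clxy (N `*` setT).
    by exists (N, setT) => //; split=> //=; exact: filterT.
  by exists x'.
have By : B y.
  apply: cB => N Ny; have [|[x' y'] [[_ By' _] [/= _ Ny']]] := clxy (setT `*` N).
    by exists (setT, N) => //; split=> //=; exact: filterT.
  by exists y'.
split=> //=; apply: hH => P Q Pg Qh.
have /= gP := cg x Ax P Pg; have /= hQ := ch y By Q Qh.
have [|[x' y'] [[/= Ax' By' e] [/= gx' hy']]] := clxy
    ([set x' | A x' -> P (g x')] `*` [set y' | B y' -> Q (h y')]).
  by exists ([set x' | A x' -> P (g x')], [set y' | B y' -> Q (h y')]).
by exists (g x'); split; [exact: gx'|rewrite e; exact: hy'].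
Qed.

(** The tube lemma, applied to the complement of [C]. *)
Lemma closed_compact_section (S T : topologicalType) (C : set (S * T)) (A : set S) :
  closed C -> compact A -> closed [set y | exists2 x, A x & C (x, y)].
Proof.
move=> cC /compact_near_coveringP cA; rewrite -openC openE => y /= Ny.
have cov := @cA T (nbhs y) (fun y' x => ~ C (x, y')) _.
have : \forall y' \near y, A `<=` (fun x => ~ C (x, y')).
  apply: cov => x Ax.
  have : nbhs (x, y) (~` C).
    apply: open_nbhs_nbhs; split; first exact: closed_openC.
    by move=> Cxy; apply: Ny; exists x.
  by move=> [[P Q] [Px Qy] PQ]; exists (P, Q) => // -[x' y'] /PQ.
by apply: filterS => y' Ny' [x Ax]; exact: Ny'.
Qed.

Lemma homeo_onto_inverse (S T : topologicalType) (A : set S) (f : S -> T) (B : set T) :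
  S -> homeo_onto A f B ->
  exists g : T -> S, {within B, continuous g} /\ forall x, A x -> g (f x) = x.
Proof.
move=> s0 [[_ inj _] _ h]; pose g y := xget s0 [set x | A x /\ f x = y].
have gf x : A x -> g (f x) = x.
  move=> Ax; rewrite /g; case: xgetP => [y _ [Ay fyx]|/(_ x)[]//].
  by apply: inj; rewrite ?inE.
by exists g; split=> //; apply: h => x; rewrite inE; exact: gf.
Qed.

Lemma metrizable_hausdorff (R : realType) (X : topologicalType) :
  metrizable R X -> hausdorff_space X.
Proof.
move=> [M [f [[_ inj _] cf _]]] p q pq.
apply: inj; rewrite ?inE //; apply: metric_hausdorff => P Q Pp Qq.
have cf' : continuous f by apply/continuous_subspace_setT.
by have [x [Px Qx]] := pq _ _ (cf' _ _ Pp) (cf' _ _ Qq); exists (f x).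
Qed.

End ClosedRelations.

(** * Additivity, and the closed subsets s^(-1)(E_I) *)

Section TameClosed.
Context {R : realType} {X : topologicalType} {d : int}.
Variable K : kuranishi_atlas R X d.
Hypothesis K_tame : tame K.
Hypothesis X_hausdorff : hausdorff_space X.

Local Notation idx := (kidx (kF K)).
Local Notation U I := (kU (katlas_chart K I)).
Local Notation E I := (kE (katlas_chart K I)).
Local Notation UU I J := (Defs.codom (kcoord K I J)).
Local Notation phi I J := (cophi (kcoord K I J)).
Local Notation hat I J := (cohat (kcoord K I J)).
Local Notation sg := (kidx_single (K := K)).
Implicit Types I J L : idx.

Lemma sg_sub I (i : 'I_(kN K)) : i \in val I -> val (sg i) \subset val I.
Proof. by move=> iI; rewrite finset.sub1set. Qed.

(** Components are indexed by all basic charts and extended by zero, so that decompositions in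
    different E_I can be compared inside a common E_L. *)
Lemma additive_decompose I (e : E I) : exists g : forall i, E (sg i),
  (forall i, i \notin val I -> g i = 0) /\
  e = \sum_(i in val I) hat (sg i) I (g i).
Proof.
have [/(_ I)[f _ fK] _ _] := K_tame.
pose a := f e; pose g (i : 'I_(kN K)) : E (sg i) :=
  if pselect (i \in val I) is left h then a (exist _ i h) else 0.
exists g; split=> [i /negP iI|]; first by rewrite /g; case: pselect.
rewrite (big_sub _ (fun i => hat (sg i) I (g i))) -{1}(fK e).
apply: eq_bigr => -[i iI] _ /=; congr (hat _ _ _); rewrite /g.
by case: pselect => // h; rewrite (bool_irrelevance h iI).
Qed.

Lemma additive_unique I (g g' : forall i, E (sg i)) :
  \sum_(i in val I) hat (sg i) I (g i) = \sum_(i in val I) hat (sg i) I (g' i) ->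
  forall i, i \in val I -> g i = g' i.
Proof.
have [/(_ I)/bij_inj inj _ _] := K_tame => e i iI.
pose a (h : forall i, E (sg i)) : {ffun forall i : {i | i \in val I}, E (sg (val i))}
  := [ffun i => h (val i)].
have : a g = a g'.
  apply: inj; move: e.
  rewrite (big_sub _ (fun i => hat (sg i) I (g i))).
  rewrite (big_sub _ (fun i => hat (sg i) I (g' i))) => e.
  under eq_bigr do rewrite ffunE.
  by under [RHS]eq_bigr do rewrite ffunE.
move=> agg; have : a g (exist _ i iI) = a g' (exist _ i iI) by rewrite agg.
by rewrite !ffunE.
Qed.

Lemma hat_decompose I L (e : E I) (g : forall i, E (sg i)) : val I \subset val L ->
  (forall i, i \notin val I -> g i = 0) ->
  e = \sum_(i in val I) hat (sg i) I (g i) ->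
  hat I L e = \sum_(i in val L) hat (sg i) L (g i).
Proof.
move=> IL g0 ->; rewrite linear_sum.
transitivity (\sum_(i in val I) hat (sg i) L (g i)).
  by apply: eq_bigr => i iI; apply: cohat_cocycle => //; exact: sg_sub.
rewrite [RHS](bigID (mem (val I))) /= [X in _ = _ + X]big1 ?addr0; last first.
  by move=> i /andP[_ /g0 ->]; rewrite linear0.
apply: eq_bigl => i; case: (boolP (i \in val I)) => iI; rewrite ?andbF ?andbT //=.
by rewrite (fintype.subsetP IL).
Qed.

(** Equal images in E_L have the same components, which vanish outside I and outside J, hence
    outside I ∩ J. *)
Lemma hat_meet I J L (e : E I) (f : E J) :
  val I \subset val L -> val J \subset val L -> hat I L e = hat J L f ->
  ((val I :&: val J)%SET = finset.set0 -> e = 0 /\ f = 0) /\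
  (forall H : idx, val H = (val I :&: val J)%SET ->
     exists g : E H, hat I L e = hat H L g).
Proof.
move=> IL JL ef; have [g [g0 gE]] := additive_decompose e.
have [h [h0 hE]] := additive_decompose f.
have gh i : g i = h i.
  have [iL|iL] := boolP (i \in val L).
    apply: (additive_unique (I := L)) iL.
    by rewrite -(hat_decompose IL g0 gE) ef -(hat_decompose JL h0 hE).
  rewrite g0 ?h0 //; [apply: contra iL; exact: (fintype.subsetP JL)|].
  by apply: contra iL; exact: (fintype.subsetP IL).
have gH i : i \notin (val I :&: val J)%SET -> g i = 0.
  by rewrite inE negb_and => /orP[/g0//|/h0]; rewrite gh.
split=> [e0|H HE].
  have g00 i : g i = 0 by rewrite gH // e0 inE.
  by rewrite gE hE; split; apply: big1 => i _; rewrite -?gh g00 linear0.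
have HI : val H \subset val I by rewrite HE finset.subsetIl.
have HL := fintype.subset_trans HI IL.
exists (\sum_(i in val H) hat (sg i) H (g i)).
rewrite (hat_decompose IL g0 gE); apply/esym; apply: hat_decompose => // i.
by rewrite HE; exact: gH.
Qed.

Lemma ks_smooth_fun I : smooth_fun (kS (katlas_chart K I)) setT
  (@vcoord R (E I) \o @ks _ _ (katlas_chart K I)).
Proof. exact: ks_smooth. Qed.

Lemma closed_ks_linear I (L : {linear E I -> E I}) :
  closed [set x : U I | L (ks x) = 0].
Proof.
(* The space E_I carries no topology here; continuity is obtained in the coordinates of a basis. *)
pose L' : {linear 'rV[R]_(\dim {:E I}) -> 'rV[R]_(\dim {:E I})} :=
  @vcoord R (E I) \o L \o passmx.vecof (vbasis {:E I}).
rewrite (_ : [set _ | _] =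
    (L' \o (@vcoord R (E I) \o @ks _ _ (katlas_chart K I))) @^-1` [set 0]).
  apply: closed_comp; last first.
    exact/accessible_closed_set1/hausdorff_accessible/norm_hausdorff.
  move=> x _; apply: continuous_comp; last exact: continuous_linear_rV.
  exact: (smooth_fun_continuous openT (@ks_smooth_fun I) Logic.I).
apply/seteqP; split=> x /=; rewrite /vcoord passmx.rVofK ?vbasisP //.
  by move=> ->; exact: vcoord0.
by move=> h; apply: vcoord_inj; rewrite vcoord0.
Qed.

Lemma closed_ks0 I : closed [set x : U I | ks x = 0].
Proof. exact: (@closed_ks_linear I idfun). Qed.

Lemma closed_ks_hat I J : closed [set x : U J | exists e : E I, ks x = hat I J e].
Proof.
pose W := limg (hat I J).
(* A linear map whose kernel is exactly the image of [hat I J]. *)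
pose L : {linear E J -> E J} := (\1 - projv W)%VF.
rewrite (_ : [set _ | _] = [set x : U J | L (ks x) = 0]); first exact: closed_ks_linear.
apply/seteqP; split=> x /=; rewrite /L.
  move=> [e ->]; rewrite !lfunE /= !lfunE /= projv_id ?subrr //.
  exact: memv_img (memvf e).
rewrite !lfunE /= !lfunE /= => /eqP; rewrite subr_eq0 => /eqP e.
have : ks x \in W by rewrite e memv_proj.
by case/memv_imgP => f _ ->; exists f.
Qed.

End TameClosed.

(** * Closedness of the equivalence relation *)

Section RelationClosed.
Context {R : realType} {X : topologicalType} {d : int}.
Variable K : kuranishi_atlas R X d.
Hypothesis K_tame : tame K.
Hypothesis X_hausdorff : hausdorff_space X.

Local Notation idx := (kidx (kF K)).
Local Notation U I := (kU (katlas_chart K I)).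
Local Notation E I := (kE (katlas_chart K I)).
Local Notation UU I J := (Defs.codom (kcoord K I J)).
Local Notation phi I J := (cophi (kcoord K I J)).
Local Notation hat I J := (cohat (kcoord K I J)).
Implicit Types H I J L N : idx.

(** Tameness with J = L = I identifies the image of φ_HI with s_I^(-1)(E_H), so the inverse of the
    embedding is continuous on a closed set. *)
Lemma cophi_hat_inverse H I : val H \subset val I -> U H ->
  exists g : U I -> U H,
    {within [set x : U I | exists e : E H, ks x = hat H I e], continuous g} /\
    forall z, UU H I z -> g (phi H I z) = z.
Proof.
move=> HI u0; have [_ _ t] := K_tame.
have [_ _ /(homeo_onto_inverse u0)[g [cg gK]]] := cophi_embedding HI.
exists g; split=> //; rewrite (_ : [set _ | _] = phi H I @` UU H I) //.
by rewrite t // kcodom_id setTI.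
Qed.

(** Equivalent points have a common source in U_H, so the relation is the locus in s_I^(-1)(E_H) ×
    s_J^(-1)(E_H) where the inverses of φ_HI and φ_HJ agree, and U_H is Hausdorff. *)
Lemma rel_closed_meet H I J : val H = (val I :&: val J)%SET ->
  closed [set p : U I * U J |
    kproj (K := K) (existT _ I p.1) = kproj (existT _ J p.2)].
Proof.
move=> HE; have HI : val H \subset val I by rewrite HE finset.subsetIl.
have HJ : val H \subset val J by rewrite HE finset.subsetIr.
have relH (x : U I) (y : U J) :
    kproj (K := K) (existT _ I x) = kproj (existT _ J y) ->
    exists z : U H, [/\ UU H I z, UU H J z, phi H I z = x & phi H J z = y].
  move=> xy; have /kproj_eqP := xy; case/(_ K_tame) => L [/= IL JL Ux Uy e].
  have HL := fintype.subset_trans HI IL.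
  have : hat I L (ks x) = hat J L (ks y) by rewrite -!cophi_section // e.
  case/(hat_meet K_tame IL JL) => _ /(_ H HE)[f fE].
  (* By additivity the section at the common image in U_L takes its value in E_H, so this image
     comes from U_H. *)
  have [z Uz zE] := cophi_lift K_tame HL (fintype.subxx _)
    (codom_self (phi I L x)) (etrans (cophi_section IL Ux) fE).
  have zx : kproj (K := K) (existT _ H z) = kproj (existT _ I x).
    by rewrite (agree_cophi K_tame HL Uz) zE -(agree_cophi K_tame IL Ux).
  have [UI zI] := agree_sub K_tame HI zx.
  by have [UJ zJ] := agree_sub K_tame HJ (etrans zx xy); exists z.
(* Total inverses into [U H] exist only if it is inhabited; otherwise no two points are related. *)
have [[u0 _]|noU] := pselect (exists u : U H, True); last first.
  rewrite (_ : [set _ | _] = set0); first exact: closed0.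
  apply/seteqP; split=> // -[x y] /relH[z _]; exfalso; apply: noU.
  by exists z.
have [g [cg gK]] := cophi_hat_inverse HI u0.
have [h [ch hK]] := cophi_hat_inverse HJ u0.
have := closed_within_eq (@kU_hausdorff _ _ (katlas_chart K H))
  (@closed_ks_hat _ _ _ K H I) (@closed_ks_hat _ _ _ K H J) cg ch.
congr closed; apply/seteqP; split=> -[x y] /=.
  move=> [[e xe] [f yf] gh].
  have [z Uz zx] := cophi_lift K_tame HI (fintype.subxx _) (codom_self x) xe.
  have [z' Uz' zy] := cophi_lift K_tame HJ (fintype.subxx _) (codom_self y) yf.
  have zz' : z = z' by rewrite -(gK z Uz) -(hK z' Uz') zx zy.
  by rewrite -zx -zy -zz' -!agree_cophi // zz'.
move=> /relH[z [UI UJ <- <-]]; rewrite gK // hK //.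
by split=> //; exists (ks z); rewrite cophi_section.
Qed.

(** Here E_I and E_J meet only in 0, so equivalent points are zeros of the sections with the same
    image in X. Conversely, a common image makes I ∪ J an index, and the zero-set condition on
    domains places both points in U_I(I ∪ J) and U_J(I ∪ J). *)
Lemma rel_closed_disjoint I J : (val I :&: val J)%SET = finset.set0 ->
  closed [set p : U I * U J |
    kproj (K := K) (existT _ I p.1) = kproj (existT _ J p.2)].
Proof.
move=> IJ0.
have [bI cI _] := kpsi_homeo (katlas_chart K I).
have [bJ cJ _] := kpsi_homeo (katlas_chart K J).
have := closed_within_eq X_hausdorff (@closed_ks0 _ _ _ K I)
  (@closed_ks0 _ _ _ K J) cI cJ.
have psi N L (x : U N) : val N \subset val L -> UU N L x -> ks x = 0 ->
    ks (phi N L x) = 0 /\ kpsi (phi N L x) = kpsi x.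
  move=> NL Ux x0; rewrite cophi_section // x0 linear0; split=> //.
  case/idx_sub_cases: NL Ux => [<-|NL] Ux; first by rewrite cophi_id.
  exact: (co_psi (coordP NL)).
congr closed; apply/seteqP; split=> -[x y] /=; last first.
  move=> /kproj_eqP; case/(_ K_tame) => L [/= IL JL Ux Uy e].
  have : hat I L (ks x) = hat J L (ks y) by rewrite -!cophi_section // e.
  case/(hat_meet K_tame IL JL) => /(_ IJ0)[x0 y0] _; split=> //.
  have [_ <-] := psi I L x IL Ux x0.
  by have [_ <-] := psi J L y JL Uy y0; rewrite e.
move=> [x0 y0 xy].
have [IJ] : kfoot (katlas_chart K I) (kpsi x) /\ kfoot (katlas_chart K J) (kpsi x).
  split; first by have [f _ _] := bI; exact: f.
  by rewrite xy; have [f _ _] := bJ; exact: f.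
rewrite !katlas_foot in IJ * => IJ'.
have nonempty N : val N != finset.set0 by have /andP[] := valP N.
have LP : kidx_pred (kF K) (val I :|: val J)%SET.
  apply/andP; split.
    have /finset.set0Pn[i iI] := nonempty I.
    by apply/finset.set0Pn; exists i; rewrite inE iI.
  apply/asboolP; exists (kpsi x) => i /=; rewrite inE => /orP[]; [exact: IJ|exact: IJ'].
pose L : idx := exist (kidx_pred (kF K)) _ LP.
(* The axioms of a coordinate change hold for strict inclusions only; strictness follows as J is
   nonempty and disjoint from I. *)
have IL : val I \proper val L.
  rewrite fintype.properE finset.subsetUl /=; apply/negP => LI.
  have /finset.set0Pn[j jJ] := nonempty J.
  have : j \in (val I :&: val J)%SET.
    by rewrite inE jJ andbT; apply: (fintype.subsetP LI); rewrite inE jJ orbT.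
  by rewrite IJ0 inE.
have JL : val J \proper val L.
  rewrite fintype.properE finset.subsetUr /=; apply/negP => LJ.
  have /finset.set0Pn[j jI] := nonempty I.
  have : j \in (val I :&: val J)%SET.
    by rewrite inE jI; apply: (fintype.subsetP LJ); rewrite inE jI.
  by rewrite IJ0 inE.
have FL : kfoot (katlas_chart K L) (kpsi x).
  by rewrite katlas_foot => i /=; rewrite inE => /orP[]; [exact: IJ|exact: IJ'].
have Ux : UU I L x.
  suff : (UU I L `&` [set x | ks x = 0]) x by case.
  by rewrite (co_zero (coordP IL)) /=; split=> //; split=> //; rewrite katlas_foot.
have Uy : UU J L y.
  suff : (UU J L `&` [set x | ks x = 0]) y by case.
  by rewrite (co_zero (coordP JL)) /= -xy; split=> //; split=> //; rewrite katlas_foot.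
have [x1 x2] := psi I L x (fintype.proper_sub IL) Ux x0.
have [y1 y2] := psi J L y (fintype.proper_sub JL) Uy y0.
apply/kproj_eqP => //; exists L; split=> //=; try exact: fintype.proper_sub.
have [[_ inj _] _ _] := kpsi_homeo (katlas_chart K L).
by apply: inj; rewrite ?inE // x2 y2.
Qed.

Lemma rel_closed I J :
  closed [set p : U I * U J |
    kproj (K := K) (existT _ I p.1) = kproj (existT _ J p.2)].
Proof.
have [e|ne] := eqVneq (val I :&: val J)%SET finset.set0; first exact: rel_closed_disjoint.
(* The footprint of I lies in that of I ∩ J, which is therefore nonempty. *)
have HP : kidx_pred (kF K) (val I :&: val J)%SET.
  rewrite /kidx_pred ne /=; apply/asboolP.
  have /andP[_ /asboolP[p pI]] := valP I.
  by exists p => i /=; rewrite inE => /andP[iI _]; exact: pI.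
exact: (@rel_closed_meet (exist (kidx_pred (kF K)) _ HP)).
Qed.

Lemma kproj_compact_closed I (A : set (U I)) : compact A ->
  closed [set kproj (K := K) (existT _ I x) | x in A].
Proof.
move=> cA; rewrite -openC; apply/qproj_openP/sigT_openP => J.
have := closed_compact_section (@rel_closed I J) cA.
by rewrite -openC.
Qed.

End RelationClosed.

(** * The perturbed zero set *)

Section Topology.

Lemma compact_set_type (T : topologicalType) (A B : set T) : compact B ->
  B `<=` A -> compact (set_val @^-1` B : set (set_type A)).
Proof.
move=> cB BA F PF FB.
have [b [Bb clb]] := cB (fmap (set_val : A -> T) F) _ FB.
have [z zb] := set_val_ex (BA b Bb); subst b; exists z; split=> // P Q FP.
rewrite nbhsE => -[W [/set_type_openP[N oN ->] Nz] WQ].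
have [||_ [[u Pu <-] Nu]] := clb (set_val @` P) N.
- by apply: (@filterS _ F _ P) => // u Pu; exists u.
- exact: open_nbhs_nbhs.
by exists u; split=> //; exact: WQ.
Qed.

Lemma compact_bigcup_fin (T : topologicalType) (I : finType) (F : I -> set T) :
  (forall i, compact (F i)) -> compact (\bigcup_i F i).
Proof.
move=> cF; rewrite (_ : \bigcup_i F i = \big[setU/set0]_(i <- index_enum I) F i).
  exact: bigsetU_compact.
rewrite -bigcup_seq; congr bigcup; apply/seteqP; split=> // i _ /=.
exact: mem_index_enum.
Qed.

Lemma closed_bigcup_fin (T : topologicalType) (I : finType) (F : I -> set T) :
  (forall i, closed (F i)) -> closed (\bigcup_i F i).
Proof.
move=> cF; rewrite (_ : \bigcup_i F i = \big[setU/set0]_(i <- index_enum I) F i).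
  by elim/big_ind : _ => //; [exact: closed0|exact: closedU].
rewrite -bigcup_seq; congr bigcup; apply/seteqP; split=> // i _ /=.
exact: mem_index_enum.
Qed.

End Topology.

Lemma dim_rowv (F : fieldType) n : \dim {: 'rV[F]_n} = n.
Proof. by rewrite dimvf /dim /= mul1n. Qed.

(** * Identifications between the zero sets *)

Section ZeroSets.
Context {R : realType} {X : topologicalType} {d : int}.
Variable K : kuranishi_atlas R X d.
Hypothesis K_tame : tame K.

Local Notation idx := (kidx (kF K)).
Local Notation U I := (kU (katlas_chart K I)).
Local Notation E I := (kE (katlas_chart K I)).
Local Notation UU I J := (Defs.codom (kcoord K I J)).
Local Notation phi I J := (cophi (kcoord K I J)).
Local Notation hat I J := (cohat (kcoord K I J)).
Local Notation SU I := (kS (katlas_chart K I)).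
Implicit Types H I J L N : idx.

Variable V : forall I, set (U I).
Variable nu : forall I, U I -> E I.
Hypothesis V_reduction : is_reduction V.
Hypothesis nu_perturbation : is_perturbation V nu.
Hypothesis nu_transverse : transverse_perturbation V nu.

Arguments V I _ : clear implicits.
Arguments nu I _ : clear implicits.

Definition zset I : set (U I) := zero_set V nu (I := I).
Arguments zset I _ : clear implicits.

Definition zpt I (z : zset I) : zspace V nu := zproj (existT _ I z).

Definition zstep_rel I J (z : zset I) (z' : zset J) : Prop :=
  UU I J (set_val z) /\ phi I J (set_val z) = set_val z'.

Lemma reduction_nested I J (x : U I) (y : U J) : closure (V I) x -> closure (V J) y ->
  kproj (K := K) (existT _ I x) = kproj (existT _ J y) ->
  (val I \subset val J) || (val J \subset val I).
Proof.
move=> Vx Vy xy; apply: (red_meet V_reduction).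
by exists (kproj (existT _ I x)); split; [exists x|exists y].
Qed.

Lemma zset_V I (z : zset I) : V I (set_val z).
Proof. by have [] := set_val_mem z. Qed.

Lemma zmap_zpt I (z : zset I) : zmap (zpt z) = kproj (existT _ I (set_val z)).
Proof. exact: (zmap_proj (existT _ I z)). Qed.

Lemma zspace_ex (q : zspace V nu) : exists I (z : zset I), zpt z = q.
Proof. by have [[I z] <-] := qproj_surj q; exists I, z. Qed.

Lemma zpt_step I J (z : zset I) (z' : zset J) : val I \subset val J ->
  zstep_rel z z' -> zpt z = zpt z'.
Proof.
move=> IJ [Uz zz']; case/idx_sub_cases: IJ => [IJ|IJ].
  subst J; rewrite cophi_id in zz'; congr zpt.
  exact: set_val_inj zz'.
by apply/qproj_eqP; apply: rst_step; exact: ZStep.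
Qed.

(** A reduction makes I and J comparable, so equivalent zeros differ by a single coordinate change,
    which is a step between zero sets. This is why [zmap] is injective. *)
Lemma kproj_zstep I J (z : zset I) (z' : zset J) :
  kproj (K := K) (existT _ I (set_val z)) = kproj (existT _ J (set_val z')) ->
  (val I \subset val J /\ zstep_rel z z') \/ (val J \subset val I /\ zstep_rel z' z).
Proof.
move=> zz'; have /orP[IJ|JI] := reduction_nested
    (subset_closure (zset_V z)) (subset_closure (zset_V z')) zz'.
  by left; split=> //; exact: agree_sub zz'.
by right; split=> //; exact: agree_sub (esym zz').
Qed.

Lemma zmap_inj : injective (@zmap _ _ _ K V nu).
Proof.
move=> p q; have [I [z <-]] := zspace_ex p; have [J [z' <-]] := zspace_ex q.
rewrite !zmap_zpt => /kproj_zstep[][IJ zz']; first exact: zpt_step.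
by apply/esym; exact: zpt_step.
Qed.

Lemma zpt_cases I J (z : zset I) (z' : zset J) : zpt z = zpt z' ->
  (val I \subset val J /\ zstep_rel z z') \/ (val J \subset val I /\ zstep_rel z' z).
Proof. by move=> e; apply: kproj_zstep; rewrite -!zmap_zpt e. Qed.

Lemma zpt_rel I J (z : zset I) (z' : zset J) : val I \subset val J ->
  zpt z = zpt z' -> zstep_rel z z'.
Proof.
by move=> IJ e; apply: agree_sub => //; rewrite -!zmap_zpt e.
Qed.

Lemma zpt_inj I : injective (@zpt I).
Proof.
move=> z z' /(zpt_rel (fintype.subxx _))[_].
by rewrite cophi_id; exact: set_val_inj.
Qed.

Lemma perturbed_cophi I J x : val I \subset val J -> V I x -> UU I J x ->
  V J (phi I J x) -> perturbed nu (phi I J x) = hat I J (perturbed nu x).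
Proof.
move=> IJ Vx Ux Vpx; rewrite /perturbed linearD cophi_section //; congr (_ + _).
case/idx_sub_cases: IJ Ux Vpx => [<-|IJ] Ux Vpx; 
  first by rewrite cophi_id; exact: esym (kcohat_id _).
by have [_ h] := nu_perturbation; exact: h.
Qed.

Lemma zset_cophi I J x : val I \subset val J -> V I x -> UU I J x ->
  V J (phi I J x) -> zset I x <-> zset J (phi I J x).
Proof.
move=> IJ Vx Ux Vpx; split=> -[_ h]; split=> //.
  by rewrite perturbed_cophi // h linear0.
by apply: (cohat_inj IJ); rewrite -perturbed_cophi // h linear0.
Qed.

Lemma zpt_continuous I : continuous (@zpt I).
Proof.
apply/continuousP => A oA; have /sigT_openP/(_ I) := (qproj_openP _).1 oA.
by [].
Qed.

Lemma perturbed_smooth I : smooth_vmap (SU I) (V I) (@perturbed _ _ _ K nu I).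
Proof.
move=> c Sc k; have oW : open (c @` (V I `&` cdom c)).
  apply: chart_open_image; last exact: subIsetr.
  by apply: openI; [exact: red_open V_reduction I|exact: cdom_open].
have [h _] := nu_perturbation.
have s1 : Ck k (c @` (V I `&` cdom c))
    (@vcoord R (E I) \o @ks _ _ (katlas_chart K I) \o cinv c).
  apply: Ck_subset (@ks_smooth _ _ (katlas_chart K I) c Sc k).
  by move=> _ [u [_ cu] <-]; exists u.
apply: Ck_eq (CkD oW s1 (h I c Sc k)) => // x _.
by rewrite /= /vcoord /perturbed linearD.
Qed.

(** Surjectivity of the differential at one zero gives dim E_I ≤ dim U_I. So [d] is nonnegative once
    a zero exists, and its absolute value is the true dimension. *)
Lemma zset_dim I (z : zset I) :
  kdim (katlas_chart K I) = (\dim {:E I} + `|d|)%N /\ 0 <= d.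
Proof.
have [c Sc cz] := charts_cover (SU I) (set_val z).
have surj := nu_transverse (set_val_mem z) Sc cz.
have le : (\dim {:E I} <= kdim (katlas_chart K I))%N.
  have := limg_ker_dim (dvmap c (@perturbed _ _ _ K nu I) (set_val z)) fullv.
  rewrite surj => e; rewrite -[leqRHS](@dim_rowv R) -e; exact: leq_addl.
have := katlas_dim I; rewrite subzn // => e.
have gen (x : int) n m : (m <= n)%N -> (n - m)%N%:Z = x -> n = (m + `|x|)%N /\ 0 <= x.
  by move=> mn <-; rewrite absz_nat subnKC.
exact: gen le e.
Qed.

Lemma zset_cover I (z : zset I) :
  exists k : chart R (set_type (zset I)) `|d|, sub_chart (SU I) k /\ cdom k z.
Proof.
have [c Sc cz] := charts_cover (SU I) (set_val z).
apply: (zero_set_chart (red_open V_reduction I) (@perturbed_smooth I) _ Sc cz).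
  by have [] := zset_dim z.
exact: nu_transverse (set_val_mem z) Sc cz.
Qed.

Lemma zset_dim_ge0 I : set_type (zset I) -> 0 <= d.
Proof. by move=> /zset_dim[]. Qed.

Definition zset_structure I : smooth_structure R (set_type (zset I)) d :=
  sub_structure (@zset_cover I) (@zset_dim_ge0 I).


Lemma cophi_preimage_open I J (B : set (U J)) : val I \subset val J -> open B ->
  open (UU I J `&` phi I J @^-1` B).
Proof.
move=> IJ oB; have [[cphi _] _ _] := cophi_embedding IJ.
exact: open_preimage_within (codom_open IJ) cphi oB.
Qed.

(** A zero in U_IJ whose image lies in V_J is automatically sent to a zero, so only the open
    conditions of lying in U_IJ and of mapping into [V J] and [N] remain. *)
Lemma zstep_up_open I J (A : set (set_type (zset J))) : val I \subset val J ->
  open A -> open [set z : zset I | exists z', A z' /\ zstep_rel z z'].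
Proof.
move=> IJ /set_type_openP[N oN ->]; apply/set_type_openP.
exists (UU I J `&` phi I J @^-1` (V J `&` N)).
  by apply: cophi_preimage_open => //; apply: openI => //; exact: red_open V_reduction J.
apply/seteqP; split=> z /=.
  move=> [z' [Nz' [Uz zz']]]; split=> //; rewrite zz'; split=> //.
  exact: zset_V.
move=> [Uz [Vz Nz]].
have /set_val_ex[z' z'E] : zset J (phi I J (set_val z)).
  by apply/(zset_cophi IJ (zset_V z) Uz Vz); exact: set_val_mem.
by exists z'; rewrite z'E.
Qed.

(** * Coordinate changes between zero sets *)

Section ZTransition.
Variables (I J : idx) (k : chart R (set_type (zset I)) `|d|)
  (k' : chart R (set_type (zset J)) `|d|).
Hypothesis IJ : val I \subset val J.
Hypothesis sk : sub_chart (SU I) k.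
Hypothesis sk' : sub_chart (SU J) k'.
Variable W : set (set_type (zset I)).
Hypothesis oW : open W.

Let W0 := W `&` (cdom k `&` [set z | exists z', cdom k' z' /\ zstep_rel z z']).

Let oW0 : open W0.
Proof.
apply: openI => //; apply: openI; first exact: cdom_open.
by apply: zstep_up_open => //; exact: cdom_open.
Qed.

Let W0k : W0 `<=` cdom k. Proof. by move=> z [_ []]. Qed.

Let W0D z : W0 z -> UU I J (set_val z).
Proof. by move=> [_ [_ [z' [_ []]]]]. Qed.

Let W0k' z : W0 z -> exists z', cdom k' z' /\ phi I J (set_val z) = set_val z'.
Proof. by move=> [_ [_ [z' [kz' [_ e]]]]]; exists z'. Qed.

Let step z z' : W0 z -> phi I J (set_val z) = set_val z' -> zpt z = zpt z'.
Proof. by move=> /W0D Uz e; apply: zpt_step. Qed.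

Let phi_smooth : smooth_map (SU I) (SU J) (UU I J) (phi I J).
Proof. by have [] := cophi_embedding IJ. Qed.

Let phi_immersion u c c' : UU I J u -> charts (SU I) c -> charts (SU J) c' ->
  cdom c u -> cdom c' (phi I J u) -> lker (dmap c c' (phi I J) u) = 0%VS.
Proof. by have [_ h _] := cophi_embedding IJ; exact: h. Qed.

Lemma zstep_smooth (T : 'rV[R]_(`|d|) -> 'rV[R]_(`|d|)) :
  (forall z z', cdom k z -> cdom k' z' -> zpt z = zpt z' -> T (k z) = k' z') ->
  smooth_on (k @` W0) T.
Proof.
move=> TE; apply: (transition_smooth (codom_open IJ) phi_smooth sk sk') => //.
by move=> z z' Wz kz' zz'; apply: TE => //; [exact: W0k|exact: step].
Qed.

(** The map φ_IJ on zeros, read from [k] to [k']. The value is unique because [zpt] is injective on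
    each zero set. *)
Let pull (y : 'rV[R]_(`|d|)) : 'rV[R]_(`|d|) := xget 0
  [set t | exists z z', [/\ cdom k z, cdom k' z', zpt z = zpt z', k z = y & k' z' = t]].

Let pullE z z' : cdom k z -> cdom k' z' -> zpt z = zpt z' -> pull (k z) = k' z'.
Proof.
move=> kz kz' zz'; rewrite /pull; case: xgetP => [t _ [u [u' [ku ku' uu' uz <-]]]|].
  have uz' : u = z by rewrite -(chartK ku) uz chartK.
  by congr (k' _); apply: zpt_inj; rewrite -zz' -uu' uz'.
by move=> /(_ (k' z'))[]; exists z, z'.
Qed.

Let pull_image : pull @` (k @` W0) =
  [set k' z' | z' in [set z' | cdom k' z' /\ exists z, W0 z /\ zstep_rel z z']].
Proof.
apply/seteqP; split=> y.
  move=> [_ [z Wz <-] <-]; have [_ [kz [z' [kz' zz']]]] := Wz.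
  exists z'; first by split=> //; exists z.
  by apply/esym/pullE => //; exact: zpt_step zz'.
move=> [z' [kz' [z [Wz zz']]] <-]; exists (k z); first by exists z.
by apply: pullE => //; [exact: W0k|exact: zpt_step zz'].
Qed.

Let pullT z z' : W0 z -> cdom k' z' -> phi I J (set_val z) = set_val z' ->
  pull (k z) = k' z'.
Proof. by move=> Wz kz' zz'; apply: pullE => //; [exact: W0k|exact: step]. Qed.

Lemma zstep_image_open :
  open [set k' z' | z' in [set z' | cdom k' z' /\ exists z, W0 z /\ zstep_rel z z']].
Proof.
rewrite -pull_image.
exact: (transition_open (codom_open IJ) phi_smooth sk sk' oW0 W0k W0D W0k'
  pullT phi_immersion).
Qed.

Lemma zstep_inverse_smooth (T : 'rV[R]_(`|d|) -> 'rV[R]_(`|d|)) :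
  (forall z z', cdom k z -> cdom k' z' -> zpt z' = zpt z -> T (k' z') = k z) ->
  smooth_on
    [set k' z' | z' in [set z' | cdom k' z' /\ exists z, W0 z /\ zstep_rel z z']] T.
Proof.
move=> TE; rewrite -pull_image.
apply: (transition_inverse_smooth (codom_open IJ) phi_smooth sk sk' oW0 W0k W0D
  W0k' pullT phi_immersion).
by move=> z z' Wz kz' zz'; apply: TE => //; [exact: W0k|exact: esym (step Wz zz')].
Qed.

End ZTransition.

(** In Z_J the saturation of [W] is, near each of its points, an image under φ_IJ or a preimage
    under φ_JI. The first is open by the inverse function theorem in equal dimensions, the second by
    continuity. *)
Lemma zpt_open I (W : set (set_type (zset I))) : open W -> open (@zpt I @` W).
Proof.
move=> oW; apply/qproj_openP/sigT_openP => J; rewrite openE => z' /= [z Wz zz'].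
have [[IJ r]|[JI r]] := zpt_cases (zz' : zpt z = zpt z').
  have [k [sk kz]] := zset_cover z; have [k' [sk' kz']] := zset_cover z'.
  have o1 := zstep_image_open IJ sk sk' oW.
  have o2 := chart_open_preimage k' o1.
  have z'in : (cdom k' `&` k' @^-1` [set k' z' | z' in [set z' | cdom k' z' /\
      exists z0, (W `&` (cdom k `&` [set z | exists z', cdom k' z' /\ zstep_rel z z'])) z0
        /\ zstep_rel z0 z']]) z'.
    split=> //; exists z' => //; split=> //; exists z; split=> //; split=> //.
    by split=> //; exists z'.
  apply: filterS (open_nbhs_nbhs (conj o2 z'in)) => u
    [ku [u' [ku' [v [[Wv _] vu']]] uu']].
  exists v => //; apply: etrans (zpt_step IJ vu') _.
  by congr zpt; rewrite -(chartK ku) -uu' chartK.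
have o1 := zstep_up_open JI oW.
have z'in : [set z : zset J | exists z', W z' /\ zstep_rel z z'] z' by exists z.
apply: filterS (open_nbhs_nbhs (conj o1 z'in)) => u [v [Wv uv]].
by exists v => //; exact: esym (zpt_step JI uv).
Qed.

(** * The smooth structure of the quotient *)

Definition zcoord I (k : chart R (set_type (zset I)) `|d|) (q : zspace V nu) :
    'rV[R]_(`|d|) :=
  xget 0 [set t | exists z, zpt z = q /\ k z = t].

Lemma zcoord_zpt I (k : chart R (set_type (zset I)) `|d|) z :
  zcoord k (zpt z) = k z.
Proof.
rewrite /zcoord; case: xgetP => [t _ [u [/zpt_inj -> ->]]//|/(_ (k z))[]].
by exists z.
Qed.

Definition zoverlap I J (k : chart R (set_type (zset I)) `|d|)
    (k' : chart R (set_type (zset J)) `|d|) :=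
  cdom k `&` @zpt I @^-1` (@zpt J @` cdom k').

Lemma zoverlap_open I J (k : chart R (set_type (zset I)) `|d|)
    (k' : chart R (set_type (zset J)) `|d|) : open (k @` zoverlap k k').
Proof.
apply: chart_open_image; last exact: subIsetl.
apply: openI; first exact: cdom_open.
apply: open_comp; first by move=> z _; exact: zpt_continuous.
by apply: zpt_open; exact: cdom_open.
Qed.

(** Near each point of the overlap the transition is a coordinate change read in charts, or the
    inverse of one, according to which index contains the other. *)
Lemma ztrans_smooth I J (k : chart R (set_type (zset I)) `|d|)
    (k' : chart R (set_type (zset J)) `|d|) :
  sub_chart (SU I) k -> sub_chart (SU J) k' ->
  smooth_on (k @` zoverlap k k') (zcoord k' \o @zpt I \o cinv k).
Proof.
move=> sk sk'; apply: smooth_local => _ [z [kz [z' kz' zz']] <-].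
have [[IJ r]|[JI r]] := zpt_cases (esym zz').
  eexists; last first.
    apply: (zstep_smooth IJ sk sk' openT) => u u' ku ku' uu'.
    by rewrite /= chartK // uu' zcoord_zpt.
  by exists z => //; split=> //; split=> //; exists z'.
eexists; last first.
  apply: (zstep_inverse_smooth JI sk' sk openT) => u' u ku' ku uu'.
  by rewrite /= chartK // uu' zcoord_zpt.
exists z => //; split=> //; exists z'; split=> //; split=> //; split=> //.
by exists z.
Qed.

Section ZChart.
Variables (I : idx) (k : chart R (set_type (zset I)) `|d|).

Let dom_open : open (@zpt I @` cdom k).
Proof. by apply: zpt_open; exact: cdom_open. Qed.

Let imageE : zcoord k @` (@zpt I @` cdom k) = k @` cdom k.
Proof.
apply/seteqP; split=> [_ [_ [z kz <-] <-]|_ [z kz <-]].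
  by rewrite zcoord_zpt; exists z.
by exists (zpt z); [exists z|rewrite zcoord_zpt].
Qed.

Let img_open : open (zcoord k @` (@zpt I @` cdom k)).
Proof. by rewrite imageE; exact: cimg_open. Qed.

Let coord_continuous : {within @zpt I @` cdom k, continuous (zcoord k)}.
Proof.
rewrite continuous_open_subspace // => q; rewrite inE => -[z kz <-] N.
rewrite zcoord_zpt => /(chart_continuous kz) Nz.
have : nbhs z (k @^-1` N) by exact: Nz.
rewrite nbhsE => -[W [oW Wz] WN].
have oz := zpt_open oW; have qz : (@zpt I @` W) (zpt z) by exists z.
apply: filterS (open_nbhs_nbhs (conj oz qz)) => _ [u Wu <-].
by rewrite /= zcoord_zpt; exact: WN.
Qed.

Let inv_continuous :
  {within zcoord k @` (@zpt I @` cdom k), continuous (@zpt I \o cinv k)}.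
Proof.
rewrite imageE continuous_open_subspace; last exact: cimg_open.
move=> y; rewrite inE => ky; apply: continuous_comp; last exact: zpt_continuous.
exact: cinv_continuous_at.
Qed.

Let coordK : {in @zpt I @` cdom k, cancel (zcoord k) (@zpt I \o cinv k)}.
Proof. by move=> q; rewrite inE => -[z kz <-]; rewrite zcoord_zpt /= chartK. Qed.

Definition zchart : chart R (zspace V nu) `|d| :=
  Chart dom_open img_open coord_continuous inv_continuous coordK.

End ZChart.

Lemma zchart_image I J (k : chart R (set_type (zset I)) `|d|)
    (k' : chart R (set_type (zset J)) `|d|) :
  zchart k @` (cdom (zchart k) `&` cdom (zchart k')) = k @` zoverlap k k'.
Proof.
apply/seteqP; split=> [_ [_ [[z kz <-] kz'] <-]|_ [z [kz kz'] <-]].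
  by exists z => //; rewrite /= zcoord_zpt.
by exists (zpt z); [split=> //; exists z|rewrite /= zcoord_zpt].
Qed.

Let zcharts : set (chart R (zspace V nu) `|d|) :=
  [set c | exists I (k : chart R (set_type (zset I)) `|d|),
     sub_chart (SU I) k /\ c = zchart k].

Let zcharts_cover q : exists2 c, zcharts c & cdom c q.
Proof.
have [I [z <-]] := zspace_ex q; have [k [sk kz]] := zset_cover z.
by exists (zchart k); [exists I, k|exists z].
Qed.

Let zcharts_compat c c' : zcharts c -> zcharts c' ->
  smooth_on (c @` (cdom c `&` cdom c')) (c' \o cinv c).
Proof.
move=> [I [k [sk ->]]] [J [k' [sk' ->]]].
by rewrite zchart_image; exact: ztrans_smooth.
Qed.

Let zspace_dim (q : zspace V nu) : 0 <= d.
Proof. by have [I [z _]] := zspace_ex q; exact: zset_dim_ge0 z. Qed.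

Definition zspace_structure : smooth_structure R (zspace V nu) d :=
  SmoothStructure zcharts_cover zcharts_compat zspace_dim.

Lemma zspace_structure_compatible : compatible_structure zspace_structure.
Proof.
exists zset_structure => I; split; first exact: sub_structure_embedding.
have orange : open (range (@zpt I)) by apply: zpt_open; exact: openT.
split=> //; first exact: zpt_inj.
  split; first by apply: continuous_subspaceT; exact: zpt_continuous.
  move=> k _ sk [J [k' [sk' ->]]]; rewrite setTI.
  exact: ztrans_smooth.
move=> g gK; split.
  rewrite continuous_open_subspace // => q; rewrite inE => -[z _ <-] N.
  rewrite gK nbhsE => -[W [oW Wz] WN].
  have oz := zpt_open oW; have qz : (@zpt I @` W) (zpt z) by exists z.
  apply: filterS (open_nbhs_nbhs (conj oz qz)) => _ [u Wu <-].
  by rewrite /= gK; exact: WN.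
move=> _ k' [J [k [sk ->]]] sk'.
rewrite (_ : _ @` _ = k @` zoverlap k k').
  apply: smooth_eq (ztrans_smooth sk sk'); first exact: zoverlap_open.
  move=> _ [z [kz [z' kz' zz']] <-].
  by rewrite /= !chartK // -zz' gK zcoord_zpt.
apply/seteqP; split=> [_ [q [[[u _ uz] [z kz zq]] gq] <-]|_ [z [kz [z' kz' zz']] <-]].
  exists z; last by rewrite -zq /= zcoord_zpt.
  by split=> //; exists u; rewrite ?zq // -(gK u) uz.
exists (zpt z); last by rewrite /= zcoord_zpt.
split; last by rewrite /preimage /= -zz' gK.
by split; [exists z'|exists z].
Qed.

(** * Separation, compactness and comparison of the topologies *)

Hypothesis X_hausdorff : hausdorff_space X.

Lemma zmap_continuous : continuous (@zmap _ _ _ K V nu).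
Proof.
apply/continuousP => A oA; apply/qproj_openP/sigT_openP => I.
have /sigT_openP/(_ I) oAI := (qproj_openP _).1 oA.
rewrite (_ : _ @^-1` _ = (set_val : zset I -> U I) @^-1`
    (existT _ I @^-1` (@kproj _ _ _ K @^-1` A))); last first.
  by apply/funext => z; rewrite /preimage /= -zmap_zpt.
by apply: open_comp => // z _; exact: set_val_continuous.
Qed.

(** Since [zpt] is open, points without disjoint neighbourhoods have representatives whose pair lies
    in the closure of the relation, hence in the relation. *)
Lemma zspace_hausdorff : hausdorff_space (zspace V nu).
Proof.
move=> p q; have [I [z <-]] := zspace_ex p; have [J [z' <-]] := zspace_ex q.
move=> cl; apply: zmap_inj; rewrite !zmap_zpt.
apply: (@rel_closed _ _ _ _ K_tame X_hausdorff I J (set_val z, set_val z')).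
move=> B [[P Q] [/= Pz Qz'] PQ].
have nz : nbhs (zpt z) (@zpt I @` (set_val @^-1` P°)).
  apply: open_nbhs_nbhs; split; last by exists z.
  apply: zpt_open; apply: open_comp; last exact: open_interior.
  by move=> ? _; exact: set_val_continuous.
have nz' : nbhs (zpt z') (@zpt J @` (set_val @^-1` Q°)).
  apply: open_nbhs_nbhs; split; last by exists z'.
  apply: zpt_open; apply: open_comp; last exact: open_interior.
  by move=> ? _; exact: set_val_continuous.
have [_ [[u Pu <-] [u' Qu' e]]] := cl _ _ nz nz'.
exists (set_val u, set_val u'); split; first by rewrite /= -!zmap_zpt e.
by apply: PQ; split; [exact: interior_subset Pu|exact: interior_subset Qu'].
Qed.

Lemma zspace_second_countable : @second_countable (zspace V nu).
Proof.
have ex I : exists B : set (set (U I)), countable B /\ basis B.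
  by have [B cB bB] := @kU_countable _ _ (katlas_chart K I); exists B.
pose B I := projT1 (cid (ex I)).
have BP I : countable (B I) /\ basis (B I) by rewrite /B; case: cid.
exists (\bigcup_(I in [set: idx]) [set @zpt I @` (set_val @^-1` N) | N in B I]).
  apply: bigcup_countable; first exact: finite_set_countable.
  by move=> I _; apply: (sub_countable (card_image_le _ _)); have [] := BP I.
split.
  move=> _ [I _ [N BN <-]]; apply: zpt_open; apply: open_comp.
    by move=> ? _; exact: set_val_continuous.
  by have [_ [h _]] := BP I; exact: h.
move=> q; have [I [z <-]] := zspace_ex q => P Pz.
have : nbhs z (@zpt I @^-1` P) by exact: zpt_continuous.
rewrite nbhsE => -[W [/set_type_openP[N' oN' ->] N'z] WP].
have [_ [_ h]] := BP I; have [N [BN Nz] NN'] := h _ _ (open_nbhs_nbhs (conj oN' N'z)).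
exists (@zpt I @` (set_val @^-1` N)).
  by split; [exists I => //; exists N|exists z].
by move=> _ [u Nu <-]; apply: WP; exact: NN'.
Qed.

Hypothesis nu_precompact : precompact_perturbation V nu.

(** A zero [z] is equivalent to some [c] in [C J], and the indices are comparable. If [c] is the
    image of [z], it is a zero; if [z] is the image of [c], injectivity of the map on obstruction
    spaces makes [c] a zero as well. *)
Lemma zset_compact_cover : exists A : forall I, set (set_type (zset I)),
  (forall I, compact (A I)) /\ forall q, exists I (z : zset I), A I z /\ zpt z = q.
Proof.
have [C [C_red _ CV] sub] := nu_precompact.
exists (fun I => set_val @^-1` (closure (C I) `&` zset I)); split=> [I|q].
  apply: compact_set_type; last exact: subIsetr.
  have oV : open (V I) by exact: red_open V_reduction I.
  pose f := @vcoord R (E I) \o @perturbed _ _ _ K nu I.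
  (* The zero set is closed only relative to [V I]. Removing the open set [W] of non-zeros from the
     compact set [closure (C I) ∩ V I] leaves a compact set. *)
  pose W := V I `&` f @^-1` (~` [set 0]).
  have oW : open W.
    have [h _] := @continuous_inP _ _ (V I) f oV; apply: h.
      by move=> x; rewrite inE; exact: (smooth_fun_continuous oV (@perturbed_smooth I)).
    apply: closed_openC; exact/accessible_closed_set1/hausdorff_accessible/norm_hausdorff.
  rewrite (_ : _ `&` _ = (closure (C I) `&` V I) `&` ~` W).
    by apply: compact_closedI; [have [] := CV I|exact: open_closedC].
  apply/seteqP; split=> x.
    by move=> [Cx [Vx px]]; split=> // -[_]; apply; rewrite /f /= px vcoord0.
  move=> [[Cx Vx] Wx]; split=> //; split=> //; apply: contrapT => px; apply: Wx.
  by split=> // fx; apply: px; apply: vcoord_inj; rewrite vcoord0.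
have [I [z <-]] := zspace_ex q.
have [[J c] /= Cc cz] : (@kproj _ _ _ K @` family_set C) (kproj (existT _ I (set_val z))).
  apply: sub; exists (existT _ I (set_val z)) => //.
  exact: set_val_mem.
have [CVJ _] := CV J; have Vc := CVJ c Cc.
have clC : closure (C J) c by exact: subset_closure.
have /orP[IJ|JI] := reduction_nested (subset_closure (zset_V z)) (subset_closure Vc)
    (esym cz).
  have [Uz zc] := agree_sub K_tame IJ (esym cz).
  have Zc : zset J c.
    rewrite -zc; apply/(zset_cophi IJ (zset_V z) Uz); rewrite ?zc //.
    exact: set_val_mem.
  have [z' z'c] := set_val_ex Zc; exists J, z'; split; first by rewrite /preimage /= z'c.
  by apply/esym/zpt_step => //; split=> //; rewrite zc.
have [Uc zc] := agree_sub K_tame JI cz.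
have Vpc : V I (phi J I c) by rewrite zc; exact: zset_V.
have Zc : zset J c by apply/(zset_cophi JI Vc Uc Vpc); rewrite zc; exact: set_val_mem.
have [z' z'c] := set_val_ex Zc; exists J, z'; split; first by rewrite /preimage /= z'c.
by apply: zpt_step => //; split; rewrite z'c.
Qed.

Lemma zspace_compact : compact [set: zspace V nu].
Proof.
have [A [cA cov]] := zset_compact_cover.
rewrite (_ : setT = \bigcup_(I : idx) (@zpt I @` A I)).
  apply: compact_bigcup_fin => I; apply: continuous_compact => //.
  by apply: continuous_subspaceT; exact: zpt_continuous.
apply/seteqP; split=> // q _; have [I [z [Az zq]]] := cov q.
by exists I => //; exists z.
Qed.

(** The compact cover writes the image of [A] as a finite union of projections of compact subsets of
    the U_I. *)
Lemma zmap_closed (A : set (zspace V nu)) : closed A ->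
  closed (@zmap _ _ _ K V nu @` A).
Proof.
move=> clA; have [B [cB cov]] := zset_compact_cover.
rewrite (_ : _ @` _ = \bigcup_(I : idx) [set kproj (K := K) (existT _ I x) |
    x in set_val @` (B I `&` @zpt I @^-1` A)]).
  apply: closed_bigcup_fin => I; apply: (kproj_compact_closed K_tame X_hausdorff).
  apply: continuous_compact.
    by apply: continuous_subspaceT; exact: set_val_continuous.
  apply: compact_closedI => //; apply: closed_comp => // z _.
  exact: zpt_continuous.
apply/seteqP; split=> [_ [q Aq <-]|_ [I _ [_ [z [Bz Az] <-] <-]]].
  have [I [z [Bz zq]]] := cov q; exists I => //.
  exists (set_val z); first by exists z => //; split=> //; rewrite /preimage /= zq.
  by rewrite -zmap_zpt zq.
by exists (zpt z) => //; rewrite zmap_zpt.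
Qed.

Lemma zmap_homeo : homeo_onto [set: zspace V nu] (@zmap _ _ _ K V nu)
  (kproj (K := K) @` family_set (zero_set V nu)).
Proof.
have cz := zmap_continuous; split.
- split=> [q _|p q _ _|_ [[I x] /= Zx <-]]; last 1 first.
  + have [z zx] := set_val_ex (Zx : zset I x); exists (zpt z) => //.
    by rewrite zmap_zpt zx.
  + have [I [z <-]] := zspace_ex q; rewrite zmap_zpt.
    by exists (existT _ I (set_val z)) => //; exact: set_val_mem.
  + exact: zmap_inj.
- exact: continuous_subspaceT.
move=> g gK; have gz q : g (zmap q) = q by apply: gK; rewrite inE.
apply/subspace_continuousP => _ [[I x] /= Zx <-].
have [z zx] := set_val_ex (Zx : zset I x); rewrite -zx -zmap_zpt.
move=> N; rewrite /from_subspace gz => Nz.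
pose W : set (zspace V nu) := interior (N : set (zspace V nu)).
have oW : open W by exact: open_interior.
have WN : W `<=` N by exact: interior_subset.
have Wz : W (zpt z) by exact: Nz.
(* By injectivity of [zmap] this open set contains the given point, and it meets the image of [zmap]
   only in the image of [W]. *)
have oC : open (~` (@zmap _ _ _ K V nu @` (~` W))).
  by apply: closed_openC; apply: zmap_closed; exact: open_closedC.
have Cz : (~` (@zmap _ _ _ K V nu @` (~` W))) (zmap (zpt z)).
  by move=> [q Wq /zmap_inj qz]; apply: Wq; rewrite qz.
apply: filterS (open_nbhs_nbhs (conj oC Cz)) => y Cy [[J t] /= Zt ty].
have [u ut] := set_val_ex (Zt : zset J t).
have yE : y = zmap (zpt u) by rewrite zmap_zpt ut.
rewrite /preimage /= yE gz; apply: WN; apply: contrapT => Wu.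
by apply: Cy; exists (zpt u).
Qed.

End ZeroSets.

Theorem proposition7p2p8 (R : realType) (X : topologicalType)
    (X_compact : compact [set: X]) (X_metrizable : metrizable R X)
    (d : int) (K : kuranishi_atlas R X d) (K_tame : tame K)
    (V : forall I : kidx (kF K), set (kU (katlas_chart K I)))
    (V_reduction : is_reduction V)
    (nu : forall I : kidx (kF K),
       kU (katlas_chart K I) -> kE (katlas_chart K I))
    (nu_perturbation : is_perturbation V nu)
    (nu_precompact : precompact_perturbation V nu)
    (nu_transverse : transverse_perturbation V nu) :
  [/\ compact [set: zspace V nu],
      hausdorff_space (zspace V nu),
      @second_countable (zspace V nu) &
      exists S : smooth_structure R (zspace V nu) d, compatible_structure S] /\
  homeo_onto [set: zspace V nu] (@zmap R X d K V nu)
    (kproj (K := K) @` family_set (zero_set V nu)).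
Proof.
have XH := metrizable_hausdorff X_metrizable.
split; last exact: (zmap_homeo K_tame V_reduction nu_perturbation XH nu_precompact).
split.
- exact: (zspace_compact K_tame V_reduction nu_perturbation nu_precompact).
- exact: (zspace_hausdorff K_tame V_reduction nu_perturbation nu_transverse XH).
- exact: (zspace_second_countable K_tame V_reduction nu_perturbation nu_transverse).
- eexists; exact: (zspace_structure_compatible K_tame V_reduction nu_perturbation
    nu_transverse).
Qed.
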